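(* The functor $\mathsf U_{\mathsf{PreLie}}$ satisfies the PBW property. Moreover, on top of the PBW filtration there exists a filtration on $\mathsf U_{\mathsf{PreLie}}(\mathfrak g)$ (for a PreLie algebra $\mathfrak g$) such that the associated graded algebra is isomorphic to $S(\mathfrak g)\otimes T(\mathfrak g)$.
   Context: $\Bbbk$ is a field of characteristic zero. A PreLie algebra is a vector space with a bilinear operation $\triangleright$ satisfying $(x\triangleright y)\triangleright z-x\triangleright(y\triangleright z)=(x\triangleright z)\triangleright y-x\triangleright(z\triangleright y)$; $\mathsf{PreLie}$ is the corresponding operad. The universal enveloping algebra $\mathsf U_{\mathsf{PreLie}}(\mathfrak g)$ (whose left modules are the $\mathfrak g$-modules in the operadic sense) is the unital associative algebra generated by two linear copies of $\mathfrak g$, with elements $r_x,l_x$ ($x\in\mathfrak g$), subject to $r_xr_y-r_yr_x=r_{x\triangleright y}-r_{y\triangleright x}$ and $l_xr_y-r_yl_x=l_yl_x-l_{x\triangleright y}$ for all $x,y\in\mathfrak g$ (up to the convention for left/right multiplications and order of products). The PBW filtration is the filtration by word length in the generators $r_x,l_x$. The PBW property of $\mathsf U_{\mathsf{PreLie}}$ means: for any PreLie algebra $\mathfrak g$ there is an isomorphism of associative algebras $\mathrm{gr}^{PBW}\,\mathsf U_{\mathsf{PreLie}}(\mathfrak g)\simeq\mathsf U_{\mathsf{PreLie}}(\mathfrak g_0)$, functorial in $\mathfrak g$, where $\mathfrak g_0$ is the same vector space with zero operation. $S(\mathfrak g)$ and $T(\mathfrak g)$ are the symmetric and tensor algebras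 of the vector space $\mathfrak g$. ''On top of the PBW filtration'' means a further filtration refining the PBW one (a filtration on the PBW associated graded). *)

(* Defs.v *)
From HB Require Import structures.
From mathcomp Require Import all_boot all_algebra.
From mathcomp Require Import finmap boolp classical_sets.
From mathcomp.multinomials Require Import monalg.

Set Implicit Arguments.
Unset Strict Implicit.
Unset Printing Implicit Defensive.

Import GRing.Theory.
Local Open Scope ring_scope.
Local Open Scope quotient_scope.

(* Ideals are proper because MathComp algebras are nonzero. *)
Record ideal (k : fieldType) (A : algType k) := Ideal {
  in_ideal :> A -> Prop;
  ideal0 : in_ideal 0;
  idealD : forall x y, in_ideal x -> in_ideal y -> in_ideal (x + y);
  idealMl : forall a x, in_ideal x -> in_ideal (a * x);
  idealMr : forall a x, in_ideal x -> in_ideal (x * a);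
  ideal_proper : ~ in_ideal 1
}.

Section QuotientAlgebra.
Context (k : fieldType) (A : algType k) (I : ideal A).

Lemma idealZ c x : I x -> I (c *: x).
Proof. by move=> Ix; rewrite -mulr_algl; apply: idealMl. Qed.

Lemma idealN x : I x -> I (- x).
Proof. by rewrite -scaleN1r; apply: idealZ. Qed.

Definition ideal_rel (x y : A) : bool := `[< I (x - y) >].

Lemma ideal_rel_equiv : equiv_class_of ideal_rel.
Proof.
split=> [x|x y|y x z].
- by apply/asboolP; rewrite subrr; apply: ideal0.
- by apply/asboolP/asboolP => /idealN; rewrite opprB.
move=> /asboolP xy /asboolP yz; apply/asboolP.
by rewrite -[x](subrK y) -addrA; apply: idealD.
Qed.

Canonical ideal_equiv := EquivRelPack ideal_rel_equiv.

Definition quotalg := {eq_quot ideal_equiv}.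

HB.instance Definition _ := EqQuotient.on quotalg.
HB.instance Definition _ := Choice.on quotalg.

Definition qpi (x : A) : quotalg := \pi_quotalg x.

Lemma qpiP x y : qpi x = qpi y <-> I (x - y).
Proof.
split=> [/eqquotP /asboolP //|h]; rewrite /qpi.
by apply/eqquotP/asboolP.
Qed.

Lemma qpi_repr (u : quotalg) : qpi (repr u) = u.
Proof. exact: reprK. Qed.

Lemma qpi_surj (u : quotalg) : exists x, u = qpi x.
Proof. by exists (repr u); rewrite qpi_repr. Qed.

Definition qadd (u v : quotalg) := qpi (repr u + repr v).
Definition qopp (u : quotalg) := qpi (- repr u).
Definition qmul (u v : quotalg) := qpi (repr u * repr v).
Definition qscale (c : k) (u : quotalg) := qpi (c *: repr u).

Lemma repr_qpi x : I (repr (qpi x) - x).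
Proof. by apply/qpiP; rewrite qpi_repr. Qed.

Lemma qaddE x y : qadd (qpi x) (qpi y) = qpi (x + y).
Proof. by apply/qpiP; rewrite opprD addrACA; apply: idealD; apply: repr_qpi. Qed.

Lemma qoppE x : qopp (qpi x) = qpi (- x).
Proof. by apply/qpiP; rewrite -opprD; apply/idealN/repr_qpi. Qed.

Lemma qmulE x y : qmul (qpi x) (qpi y) = qpi (x * y).
Proof.
apply/qpiP; set x' := repr _; set y' := repr _.
have -> : x' * y' - x * y = (x' - x) * y' + x * (y' - y).
  by rewrite mulrBl mulrBr addrA subrK.
by apply: idealD; [apply: idealMr|apply: idealMl]; apply: repr_qpi.
Qed.

Lemma qscaleE c x : qscale c (qpi x) = qpi (c *: x).
Proof. by apply/qpiP; rewrite -scalerBr; apply/idealZ/repr_qpi. Qed.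

Lemma qaddA : associative qadd.
Proof.
by move=> u v w; have [[[x ->] [y ->]] [z ->]] := (qpi_surj u, qpi_surj v, qpi_surj w);
  rewrite !qaddE addrA.
Qed.

Lemma qaddC : commutative qadd.
Proof.
by move=> u v; have [[x ->] [y ->]] := (qpi_surj u, qpi_surj v);
  rewrite !qaddE addrC.
Qed.

Lemma qadd0 : left_id (qpi 0) qadd.
Proof. by move=> u; have [x ->] := qpi_surj u; rewrite qaddE add0r. Qed.

Lemma qaddN : left_inverse (qpi 0) qopp qadd.
Proof. by move=> u; have [x ->] := qpi_surj u; rewrite qoppE qaddE addNr. Qed.

Lemma qmulA : associative qmul.
Proof.
by move=> u v w; have [[[x ->] [y ->]] [z ->]] := (qpi_surj u, qpi_surj v, qpi_surj w);
  rewrite !qmulE mulrA.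
Qed.

Lemma qmul1l : left_id (qpi 1) qmul.
Proof. by move=> u; have [x ->] := qpi_surj u; rewrite qmulE mul1r. Qed.

Lemma qmul1r : right_id (qpi 1) qmul.
Proof. by move=> u; have [x ->] := qpi_surj u; rewrite qmulE mulr1. Qed.

Lemma qmulDl : left_distributive qmul qadd.
Proof.
by move=> u v w; have [[[x ->] [y ->]] [z ->]] := (qpi_surj u, qpi_surj v, qpi_surj w);
  rewrite !(qaddE, qmulE) mulrDl.
Qed.

Lemma qmulDr : right_distributive qmul qadd.
Proof.
by move=> u v w; have [[[x ->] [y ->]] [z ->]] := (qpi_surj u, qpi_surj v, qpi_surj w);
  rewrite !(qaddE, qmulE) mulrDr.
Qed.

Lemma qone_neq0 : qpi 1 != qpi 0.
Proof. by apply/eqP => /qpiP; rewrite subr0; apply: (@ideal_proper _ _ I). Qed.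

HB.instance Definition _ := GRing.isNzRing.Build quotalg
  qaddA qaddC qadd0 qaddN qmulA qmul1l qmul1r qmulDl qmulDr qone_neq0.

Lemma qpiD x y : qpi x + qpi y = qpi (x + y).
Proof. exact: qaddE. Qed.

Lemma qpiM x y : qpi x * qpi y = qpi (x * y).
Proof. exact: qmulE. Qed.

Lemma qscaleA c d u : qscale c (qscale d u) = qscale (c * d) u.
Proof. by have [x ->] := qpi_surj u; rewrite !qscaleE scalerA. Qed.

Lemma qscale1 : left_id 1 qscale.
Proof. by move=> u; have [x ->] := qpi_surj u; rewrite qscaleE scale1r. Qed.

Lemma qscaleDr : right_distributive qscale +%R.
Proof.
move=> c u v; have [[x ->] [y ->]] := (qpi_surj u, qpi_surj v).
by rewrite !(qscaleE, qpiD) scalerDr.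
Qed.

Lemma qscaleDl u : {morph qscale^~ u : c d / c + d}.
Proof.
move=> c d; have [x ->] := qpi_surj u.
by rewrite !(qscaleE, qpiD) scalerDl.
Qed.

HB.instance Definition _ := GRing.Zmodule_isLmodule.Build k quotalg
  qscaleA qscale1 qscaleDr qscaleDl.

Lemma qpiZ c x : c *: qpi x = qpi (c *: x).
Proof. exact: qscaleE. Qed.

Lemma qscaleAl c (u v : quotalg) : c *: (u * v) = (c *: u) * v.
Proof.
have [[x ->] [y ->]] := (qpi_surj u, qpi_surj v).
by rewrite !(qpiM, qpiZ) scalerAl.
Qed.

HB.instance Definition _ := GRing.Lmodule_isLalgebra.Build k quotalg qscaleAl.

Lemma qscaleAr c (u v : quotalg) : c *: (u * v) = u * (c *: v).
Proof.
have [[x ->] [y ->]] := (qpi_surj u, qpi_surj v).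
by rewrite !(qpiM, qpiZ) scalerAr.
Qed.

HB.instance Definition _ := GRing.Lalgebra_isAlgebra.Build k quotalg qscaleAr.

Lemma qpi_is_linear : linear qpi.
Proof. by move=> c x y; rewrite qpiZ qpiD. Qed.

Lemma qpi_is_monoid_morphism : monoid_morphism qpi.
Proof. by split=> // x y; rewrite qpiM. Qed.

HB.instance Definition _ := GRing.isLinear.Build k A quotalg _ qpi qpi_is_linear.
HB.instance Definition _ :=
  GRing.isMonoidMorphism.Build A quotalg qpi qpi_is_monoid_morphism.

Lemma qpi_add x y : qpi (x + y) = qpi x + qpi y. Proof. exact: raddfD. Qed.
Lemma qpi_opp x : qpi (- x) = - qpi x. Proof. exact: raddfN. Qed.
Lemma qpi_scale c x : qpi (c *: x) = c *: qpi x. Proof. exact: linearZZ. Qed.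
Lemma qpi_mul x y : qpi (x * y) = qpi x * qpi y. Proof. exact: rmorphM. Qed.
Lemma qpi_one : qpi 1 = 1. Proof. by []. Qed.

Definition qpiE := (qpi_add, qpi_opp, qpi_scale, qpi_mul).

Lemma qpi_eq0 x : qpi x = 0 <-> I x.
Proof. by rewrite -[0]/(qpi 0) qpiP subr0. Qed.

Section Lift.
Context (B : algType k) (f : {lrmorphism A -> B}).
Hypothesis fI : forall x, I x -> f x = 0.

Definition quotalg_lift (u : quotalg) : B := f (repr u).

Lemma quotalg_liftE x : quotalg_lift (qpi x) = f x.
Proof.
by apply/eqP; rewrite -subr_eq0 -rmorphB; apply/eqP/fI/repr_qpi.
Qed.

Lemma quotalg_lift_is_linear : linear quotalg_lift.
Proof.
move=> c u v; have [[x ->] [y ->]] := (qpi_surj u, qpi_surj v).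
by rewrite -linearP !quotalg_liftE linearP.
Qed.

Lemma quotalg_lift_is_monoid_morphism : monoid_morphism quotalg_lift.
Proof.
split=> [|u v]; first by rewrite -[1]/(qpi 1) quotalg_liftE rmorph1.
have [[x ->] [y ->]] := (qpi_surj u, qpi_surj v).
by rewrite -rmorphM !quotalg_liftE rmorphM.
Qed.

End Lift.
End QuotientAlgebra.

Section GeneratedIdeal.
Context (k : fieldType) (A : algType k) (R : A -> Prop).

Inductive gen_ideal : A -> Prop :=
| Gen_base x of R x : gen_ideal x
| Gen_zero : gen_ideal 0
| Gen_add x y of gen_ideal x & gen_ideal y : gen_ideal (x + y)
| Gen_mull a x of gen_ideal x : gen_ideal (a * x)
| Gen_mulr a x of gen_ideal x : gen_ideal (x * a).

Definition ideal_of (proper : ~ gen_ideal 1) : ideal A :=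
  Ideal Gen_zero Gen_add Gen_mull Gen_mulr proper.

Lemma gen_ideal_morph (B : algType k) (f : {lrmorphism A -> B}) :
  (forall x, R x -> f x = 0) -> forall x, gen_ideal x -> f x = 0.
Proof.
move=> fR x; elim=> {x} [x /fR //||x y _ fx _ fy|a x _ fx|a x _ fx].
- exact: rmorph0.
- by rewrite rmorphD /= fx fy addr0.
- by rewrite rmorphM /= fx mulr0.
- by rewrite rmorphM /= fx mul0r.
Qed.

Lemma gen_ideal_proper (B : algType k) (f : {lrmorphism A -> B}) :
  (forall x, R x -> f x = 0) -> ~ gen_ideal 1.
Proof.
by move=> fR /(gen_ideal_morph fR)/eqP; rewrite rmorph1 oner_eq0.
Qed.

End GeneratedIdeal.

Section FreeAlgebra.
Context (k : fieldType) (X : choiceType).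

Lemma malg_scaleAr c (u v : {malg k[{fmonom X}]}) : c *: (u * v) = u * (c *: v).
Proof.
apply/malgP => m; apply: etrans (mcoeffZ c (u * v) m) _.
apply: etrans (congr1 ( *%R c) (mcoeffMl u v m)) _.
rewrite (mcoeffMlw m (fsubset_refl (msupp u)) (msuppZ_le c v)) mulr_sumr.
apply: eq_bigr => m1 _; rewrite mulr_sumr; apply: eq_bigr => m2 _.
by rewrite mcoeffZ mulrCA mulrnAr.
Qed.

Definition freealg : Type := {malg k[{fmonom X}]}.

HB.instance Definition _ := GRing.Lalgebra.on freealg.
HB.instance Definition _ := GRing.Lalgebra_isAlgebra.Build k freealg malg_scaleAr.

(* Locked: unification would otherwise unfold it down to finite maps. *)
Fact fgen_key : unit. Proof. exact: tt. Qed.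
Definition fgen (x : X) : freealg := locked_with fgen_key << fmu x >>.

Lemma fgenE x : fgen x = << fmu x >>.
Proof. by rewrite /fgen unlock. Qed.

Section Eval.
Context (B : algType k) (h : X -> B).

Definition word_eval (w : {fmonom X}) : B := \prod_(x <- w) h x.

Lemma word_eval_mmorphism : mmorphism word_eval.
Proof.
split=> [u v|]; last by rewrite /word_eval fm1 big_nil.
by rewrite /word_eval fmM big_cat.
Qed.

HB.instance Definition _ :=
  monalg.isMultiplicative.Build {fmonom X} B word_eval word_eval_mmorphism.

Definition feval (u : freealg) : B := mmap (in_alg B) word_eval u.

Lemma feval_is_linear : linear feval.
Proof.
move=> c u v; rewrite /feval mmapD; congr (_ + _).
by rewrite (mmapZ c u) /= mulr_algl.
Qed.

Lemma feval_is_monoid_morphism : monoid_morphism feval.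
Proof.
have [M one] : multiplicative (mmap (in_alg B) word_eval).
  apply: commr_mmap_is_multiplicative => u m m' /=.
  by rewrite /GRing.comm mulr_algl mulr_algr.
by split.
Qed.

HB.instance Definition _ := GRing.isLinear.Build k freealg B _ feval feval_is_linear.
HB.instance Definition _ :=
  GRing.isMonoidMorphism.Build freealg B feval feval_is_monoid_morphism.

Lemma feval_gen x : feval (fgen x) = h x.
Proof. by rewrite /feval fgenE mmapU /word_eval fmU big_seq1 /= scale1r mul1r. Qed.

Lemma fevalD u v : feval (u + v) = feval u + feval v.
Proof. exact: raddfD. Qed.

Lemma fevalN u : feval (- u) = - feval u.
Proof. exact: raddfN. Qed.

Lemma fevalZ c u : feval (c *: u) = c *: feval u.
Proof. exact: linearZZ. Qed.

Lemma fevalM u v : feval (u * v) = feval u * feval v.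
Proof. exact: rmorphM. Qed.

Lemma feval1 : feval 1 = 1.
Proof. exact: rmorph1. Qed.

Definition fevalE := (fevalD, fevalN, fevalZ, fevalM, feval1, feval_gen).

End Eval.

Lemma fwordE (s : seq X) :
  \prod_(x <- s) fgen x = << fmonom_of_seq fmonom_key s >> :> freealg.
Proof.
elim: s => [|x s IH]; first by rewrite big_nil.
rewrite big_cons IH fgenE; apply: etrans (fgmulUU _ _ _ _) _.
rewrite mulr1; congr (<< _ >>); apply/eqP.
by rewrite -val_eqE /= fmM fmU !fmE.
Qed.

Lemma freealgE (u : freealg) :
  u = \sum_(w <- msupp u) u@_w *: \prod_(x <- w) fgen x.
Proof.
rewrite {1}[u]monalgE; apply: eq_bigr => w _; rewrite fwordE.
have -> : fmonom_of_seq fmonom_key w = w by rewrite fmE fmK.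
apply/malgP => m; apply: esym; apply: etrans (mcoeffZ _ _ _) _.
by rewrite !mcoeffU mulrnAr mulr1.
Qed.

Lemma freealg_functional (H : seq X -> k) :
  exists2 T : freealg -> k, linear (T : freealg -> k^o) &
    forall s, T (\prod_(x <- s) fgen x) = H s.
Proof.
pose H' (w : {fmonom X}) := H w.
exists (fun u => mmap (@idfun k : {additive k -> k}) H' u) => [c u v|s].
  rewrite mmapD; congr (_ + _).
  rewrite (mmapEw (msuppZ_le c u)) /mmap scaler_sumr.
  by apply: eq_bigr => w _; rewrite mcoeffZ /= scalerAl.
by rewrite fwordE mmapU /= mul1r /H' fmE.
Qed.

End FreeAlgebra.

Arguments fgen {k X} x.

(* The augmentation of a free algebra, killing every generator. *)
Notation faug := (feval (fun=> 0 : GRing.regular _)).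

Definition right_symmetric (V : zmodType) (op : V -> V -> V) :=
  forall x y z, op (op x y) z - op x (op y z) = op (op x z) y - op x (op z y).

HB.mixin Record isPreLie (k : fieldType) V of GRing.Lmodule k V := {
  prelie : V -> V -> V;
  prelie_is_linearl : forall y, linear (prelie^~ y);
  prelie_is_linearr : forall x, linear (prelie x);
  prelie_rsym : right_symmetric prelie
}.

#[short(type="preLieType")]
HB.structure Definition PreLie (k : fieldType) :=
  {V of isPreLie k V & GRing.Lmodule k V}.

Notation "x ▷ y" := (prelie x y) (at level 40, left associativity) : ring_scope.

Record prelie_hom (k : fieldType) (g h : preLieType k) := PreLieHom {
  prelie_hom_fun :> {linear g -> h};
  prelie_homM : forall x y, prelie_hom_fun (x ▷ y) = prelie_hom_fun x ▷ prelie_hom_fun y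
}.

Definition null_prelie (k : fieldType) (g : lmodType k) : Type := g.

Section NullPreLie.
Context (k : fieldType) (g : lmodType k).

HB.instance Definition _ := GRing.Lmodule.on (null_prelie g).

Definition zero_op (x y : null_prelie g) : null_prelie g := 0.

Lemma zero_linearl y : linear (zero_op^~ y).
Proof. by move=> c u v; rewrite /zero_op scaler0 addr0. Qed.

Lemma zero_linearr x : linear (zero_op x).
Proof. by move=> c u v; rewrite /zero_op scaler0 addr0. Qed.

Lemma zero_rsym : right_symmetric zero_op.
Proof. by []. Qed.

HB.instance Definition _ :=
  isPreLie.Build k (null_prelie g) zero_linearl zero_linearr zero_rsym.
End NullPreLie.

Definition null_hom (k : fieldType) (g h : lmodType k) (f : {linear g -> h}) :
    prelie_hom (null_prelie g) (null_prelie h) :=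
  @PreLieHom k (null_prelie g) (null_prelie h) f (fun _ _ => linear0 f).

(* The operators of a module M, that is of a square-zero extension of g by M
   with m ▷ x = R x m and x ▷ m = L x m, satisfy exactly the relations imposed
   on r and l below when products are read as compositions. *)
Lemma prelie_moduleP (k : fieldType) (g : preLieType k) (M : lmodType k)
    (R L : g -> {linear M -> M}) :
  right_symmetric (fun u v : (g * M)%type => (u.1 ▷ v.1, R v.1 u.2 + L u.1 v.2)) <->
  (forall x y m, R x (R y m) - R y (R x m) = R (y ▷ x) m - R (x ▷ y) m) /\
  (forall x y m, L x (R y m) - R y (L x m) = L x (L y m) - L (x ▷ y) m).
Proof.
have sub2 (V : zmodType) (a b c d : V) : a - b = c - d -> a - c = b - d.
  move=> /eqP; rewrite -subr_eq0 opprB addrACA [- b - c]addrC addrACA -[d - b]opprB.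
  by rewrite subr_eq0 => /eqP.
have sum3 (V : zmodType) (a b c d e f : V) :
    a + b + c + (- d + (- e - f)) = (a - d) + ((b - e) + (c - f)).
  by rewrite -[a + b + c]addrA addrACA; congr (_ + _); rewrite addrACA.
split=> [S|[RR LR] [x m] [y n] [z p]].
  split=> x y m.
    have /(congr1 snd) := S (0, m) (x, 0) (y, 0).
    rewrite /= !(linear0, addr0, add0r) => /sub2 E.
    by apply: oppr_inj; rewrite !opprB.
  have /(congr1 snd) := S (x, 0) (0, m) (y, 0).
  rewrite /= !(linear0, addr0, add0r) => E.
  by apply: oppr_inj; rewrite !opprB.
apply: injective_projections; rewrite /=; first exact: prelie_rsym.
rewrite !raddfD /= !sum3 [X in _ = _ + X]addrC; congr (_ + (_ + _)).
- by apply: oppr_inj; rewrite !opprB; apply: sub2; rewrite -RR.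
- by apply: oppr_inj; rewrite !opprB; apply: LR.
- by apply: oppr_inj; rewrite !opprB -LR.
Qed.

(* Left modules over this algebra are the g-modules (prelie_moduleP). The
   opposite order of products gives the opposite algebra, with relations
   r_x r_y - r_y r_x = r_(x ▷ y) - r_(y ▷ x) and
   l_x r_y - r_y l_x = l_(x ▷ y) - l_y l_x. *)
Section Enveloping.
Context (k : fieldType) (g : preLieType k).

Local Notation F := (freealg k (g + g)%type).
Local Notation r x := (fgen (inl x : g + g) : F).
Local Notation l x := (fgen (inr x : g + g) : F).

Inductive U_rel : F -> Prop :=
| U_rel_r c x y : U_rel (r (c *: x + y) - (c *: r x + r y))
| U_rel_l c x y : U_rel (l (c *: x + y) - (c *: l x + l y))
| U_rel_rr x y : U_rel (r x * r y - r y * r x - (r (y ▷ x) - r (x ▷ y)))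
| U_rel_lr x y : U_rel (l x * r y - r y * l x - (l x * l y - l (x ▷ y))).

Lemma U_proper : ~ gen_ideal U_rel 1.
Proof.
apply: (@gen_ideal_proper k F U_rel k^o faug) => _ [c x y|c x y|x y|x y].
all: by rewrite /= !fevalE /= ?(mul0r, mulr0, scaler0, addr0, oppr0).
Qed.

Definition U_ideal : ideal F := ideal_of U_proper.

Definition U_PreLie : algType k := quotalg U_ideal.

Definition Ugen (i : g + g) : U_PreLie := qpi U_ideal (fgen i).
Definition Ur (x : g) : U_PreLie := Ugen (inl x).
Definition Ul (x : g) : U_PreLie := Ugen (inr x).

Lemma U_rel0 (u : F) : U_rel u -> qpi U_ideal u = 0.
Proof. by move=> Ru; apply/qpi_eq0; apply: Gen_base. Qed.

Lemma Ur_is_linear : linear Ur.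
Proof. by move=> c x y; move/U_rel0: (U_rel_r c x y); rewrite !qpiE => /subr0_eq. Qed.

Lemma Ul_is_linear : linear Ul.
Proof. by move=> c x y; move/U_rel0: (U_rel_l c x y); rewrite !qpiE => /subr0_eq. Qed.

HB.instance Definition _ := GRing.isLinear.Build k g U_PreLie _ Ur Ur_is_linear.
HB.instance Definition _ := GRing.isLinear.Build k g U_PreLie _ Ul Ul_is_linear.

Lemma U_rr x y : Ur x * Ur y - Ur y * Ur x = Ur (y ▷ x) - Ur (x ▷ y).
Proof. by move/U_rel0: (U_rel_rr x y); rewrite !qpiE => /subr0_eq. Qed.

Lemma U_lr x y : Ul x * Ur y - Ur y * Ul x = Ul x * Ul y - Ul (x ▷ y).
Proof. by move/U_rel0: (U_rel_lr x y); rewrite !qpiE => /subr0_eq. Qed.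

End Enveloping.

Arguments Ugen {k g} i.
Arguments Ur {k g} x.
Arguments Ul {k g} x.

Section EnvelopingLift.
Context (k : fieldType) (g : preLieType k) (B : algType k).
Context (R L : {linear g -> B}).
Hypothesis RR : forall x y, R x * R y - R y * R x = R (y ▷ x) - R (x ▷ y).
Hypothesis LR : forall x y, L x * R y - R y * L x = L x * L y - L (x ▷ y).

Definition U_lift_gen (i : g + g) : B :=
  match i with inl x => R x | inr x => L x end.

Lemma U_lift_subproof x : U_ideal g x -> feval U_lift_gen x = 0.
Proof.
apply: gen_ideal_morph => _ [c x1 y|c x1 y|x1 y|x1 y] /=; rewrite !fevalE /=.
- by rewrite linearP subrr.
- by rewrite linearP subrr.
- by rewrite RR subrr.
- by rewrite LR subrr.
Qed.

Definition U_lift : U_PreLie g -> B := quotalg_lift (feval U_lift_gen).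

Lemma U_lift_is_linear : linear U_lift.
Proof. exact: quotalg_lift_is_linear U_lift_subproof. Qed.

Lemma U_lift_is_monoid_morphism : monoid_morphism U_lift.
Proof. exact: quotalg_lift_is_monoid_morphism U_lift_subproof. Qed.

Lemma U_lift_gen_eq i : U_lift (Ugen i) = U_lift_gen i.
Proof. by rewrite /U_lift (quotalg_liftE U_lift_subproof) /= feval_gen. Qed.

End EnvelopingLift.

Section EnvelopingFunctor.
Context (k : fieldType) (g h : preLieType k) (f : prelie_hom g h).

Definition Rf : {linear g -> U_PreLie h} := (@Ur k h) \o f.
Definition Lf : {linear g -> U_PreLie h} := (@Ul k h) \o f.

Definition U_map : U_PreLie g -> U_PreLie h := U_lift Rf Lf.

Lemma Rf_rr x y : Rf x * Rf y - Rf y * Rf x = Rf (y ▷ x) - Rf (x ▷ y).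
Proof. by rewrite /= !prelie_homM; apply: U_rr. Qed.

Lemma Lf_lr x y : Lf x * Rf y - Rf y * Lf x = Lf x * Lf y - Lf (x ▷ y).
Proof. by rewrite /= !prelie_homM; apply: U_lr. Qed.

HB.instance Definition _ :=
  GRing.isLinear.Build k (U_PreLie g) (U_PreLie h) _ U_map
    (U_lift_is_linear Rf_rr Lf_lr).
HB.instance Definition _ :=
  GRing.isMonoidMorphism.Build (U_PreLie g) (U_PreLie h) U_map
    (U_lift_is_monoid_morphism Rf_rr Lf_lr).

Lemma U_map_r x : U_map (Ur x) = Ur (f x).
Proof. exact: (U_lift_gen_eq Rf_rr Lf_lr). Qed.

Lemma U_map_l x : U_map (Ul x) = Ul (f x).
Proof. exact: (U_lift_gen_eq Rf_rr Lf_lr). Qed.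

End EnvelopingFunctor.

Section TensorSymmetricAlgebras.
Context (k : fieldType) (V : lmodType k).

Local Notation F := (freealg k V).
Local Notation X x := (fgen (x : V) : F).

Inductive T_rel : F -> Prop :=
| T_rel_lin c x y : T_rel (X (c *: x + y) - (c *: X x + X y)).

Inductive S_rel : F -> Prop :=
| S_rel_lin c x y : S_rel (X (c *: x + y) - (c *: X x + X y))
| S_rel_comm x y : S_rel (X x * X y - X y * X x).

Lemma T_proper : ~ gen_ideal T_rel 1.
Proof.
apply: (@gen_ideal_proper k F T_rel k^o faug) => _ [c x y].
by rewrite /= !fevalE /= scaler0 addr0 oppr0 addr0.
Qed.

Lemma S_proper : ~ gen_ideal S_rel 1.
Proof.
apply: (@gen_ideal_proper k F S_rel k^o faug) => _ [c x y|x y].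
all: by rewrite /= !fevalE /= ?mul0r ?scaler0 ?addr0 oppr0 ?addr0.
Qed.

Definition tensor_algebra : algType k := quotalg (ideal_of T_proper).
Definition symmetric_algebra : algType k := quotalg (ideal_of S_proper).

End TensorSymmetricAlgebras.

(* Every algebra over a field has a linear functional not killing 1; used
   only to see that a tensor product of algebras is nonzero. *)
Lemma unital_functional (k : fieldType) (A : algType k) :
  exists2 phi : A -> k, (forall c x y, phi (c *: x + y) = c * phi x + phi y) & phi 1 = 1.
Proof.
pose P (W : set A) := [/\ forall x y, W x -> W y -> W (x + y),
  forall (c : k) x, W x -> W (c *: x) & ~ W 1].
have [F FP Ftot|W [[WD WZ W1] Wmax]] := @Zorn_bigcup A P.
  split.
  - move=> x y [U FU Ux] [V FV Vy].
    have [UV|VU] := Ftot _ _ FU FV.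
      by exists V => //; have [VD _ _] := FP _ FV; apply: VD => //; apply: UV.
    by exists U => //; have [UD _ _] := FP _ FU; apply: UD => //; apply: VU.
  - move=> c x [U FU Ux]; exists U => //.
    by have [_ UZ _] := FP _ FU; apply: UZ.
  - by move=> [U FU U1]; have [_ _] := FP _ FU; apply.
pose W0 x := W x \/ x = 0.
have W0D x y : W0 x -> W0 y -> W0 (x + y).
  move=> [Wx|->] [Wy|->]; rewrite ?(addr0, add0r); try by [left|right].
  by left; apply: WD.
have W0Z (c : k) x : W0 x -> W0 (c *: x).
  by move=> [Wx|->]; [left; apply: WZ|right; rewrite scaler0].
have W01 : ~ W0 1 by move=> [//|/eqP]; rewrite oner_eq0.
have dec x : exists c : k, W0 (x - c *: 1).
  have [Wx|nWx] := pselect (W x); first by exists 0; rewrite scale0r subr0; left.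
  have [w W0w [c E]] : exists2 w, W0 w & exists c : k, 1 = w + c *: x.
    apply: contrapT => N; pose W' y := exists2 w, W0 w & exists c : k, y = w + c *: x.
    apply: (Wmax W'); last split.
    - split=> [w Ww|]; first by exists w; [left|exists 0; rewrite scale0r addr0].
      by move=> /(_ x) W'x; apply/nWx/W'x; exists 0; [right|exists 1; rewrite add0r scale1r].
    - move=> _ _ [w Ww [c ->]] [v Wv [d ->]]; exists (w + v); first exact: W0D.
      by exists (c + d); rewrite scalerDl addrACA.
    - move=> d _ [w Ww [c ->]]; exists (d *: w); first exact: W0Z.
      by exists (d * c); rewrite scalerDr scalerA.
    - by case=> w Ww [c E]; apply: N; exists w => //; exists c.
  have c0 : c != 0.
    by apply/eqP => c0; apply: W01; rewrite E c0 scale0r addr0.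
  exists c^-1; have -> : x - c^-1 *: 1 = - c^-1 *: w.
    by rewrite E scalerDr scalerA mulVf // scale1r opprD addrCA subrr addr0 scaleNr.
  exact: W0Z.
have [phi phiP] := choice dec; have W0_scal (c : k) : W0 (c *: 1) -> c = 0.
  move=> Wc; apply/eqP/negPn/negP => c0; apply: W01.
  by rewrite -[1](scale1r (1 : A)) -(mulVf c0) -scalerA; apply: W0Z.
have phiE x c : W0 (x - c *: 1) -> phi x = c.
  move=> Wc; apply/eqP; rewrite -subr_eq0; apply/eqP/W0_scal.
  have -> : (phi x - c) *: (1 : A) = (x - c *: 1) + (-1) *: (x - phi x *: 1).
    by rewrite scaleN1r opprB [RHS]addrC addrA subrK scalerBl.
  by apply: W0D => //; apply: W0Z.
exists phi => [c x y|]; apply: phiE; last by rewrite scale1r subrr; right.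
have -> : c *: x + y - (c * phi x + phi y) *: 1 =
  c *: (x - phi x *: 1) + (y - phi y *: 1).
  by rewrite scalerDl -scalerA scalerBr opprD addrACA.
by apply: W0D => //; apply: W0Z.
Qed.

(* A (x) B, presented by the pure tensors: bilinearity and the rule
   (a (x) b)(a' (x) b') = aa' (x) bb' make them span the algebra. *)
Section TensorProduct.
Context (k : fieldType) (A B : algType k).

Local Notation F := (freealg k (A * B)%type).
Local Notation "a ⊗ b" := (fgen (a, b) : F) (at level 40).

Inductive tensor_rel : F -> Prop :=
| tensor_rel_linl c a a' b :
    tensor_rel ((c *: a + a') ⊗ b - (c *: (a ⊗ b) + a' ⊗ b))
| tensor_rel_linr c a b b' :
    tensor_rel (a ⊗ (c *: b + b') - (c *: (a ⊗ b) + a ⊗ b'))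
| tensor_rel_mul a b a' b' :
    tensor_rel ((a ⊗ b) * (a' ⊗ b') - (a * a') ⊗ (b * b'))
| tensor_rel_one : tensor_rel (1 ⊗ 1 - 1).

Lemma tensor_proper : ~ gen_ideal tensor_rel 1.
Proof.
have [phi phiP phi1] := unital_functional A.
have [psi psiP psi1] := unital_functional B.
pose H (s : seq (A * B)) : k :=
  phi (\prod_(x <- s) x.1) * psi (\prod_(x <- s) x.2).
have [T Tlin TH] := freealg_functional H.
pose W (s : seq (A * B)) : F := \prod_(x <- s) fgen x.
have Wgen x : fgen x = W [:: x] by rewrite /W big_seq1.
have Wcat s t : W s * W t = W (s ++ t) by rewrite /W big_cat.
have Wone : 1 = W [::] by rewrite /W big_nil.
have WE (a : F) : exists c : {fmonom (A * B)%type} -> k, exists r, a = \sum_(w <- r) c w *: W w.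
  by exists (fun w => a@_w); exists (msupp a); apply: freealgE.
have [G [GW GL GR]] : exists G : seq (A * B) -> seq (A * B) -> {linear F -> k^o},
  [/\ forall s t u, G s t (W u) = H (s ++ u ++ t),
      forall s t w x, G s t (W w * x) = G (s ++ w) t x &
      forall s t w x, G s t (x * W w) = G s (w ++ t) x].
  pose G s t (x : F) : k^o := T (W s * x * W t).
  have Glin s t : linear (G s t).
    by move=> c x y; rewrite /G mulrDr -scalerAr mulrDl -scalerAl; apply: Tlin.
  pose G' s t : {linear F -> k^o} :=
    HB.pack (G s t) (GRing.isLinear.Build k F k^o _ (G s t) (Glin s t)).
  exists G'; split=> [s t u|s t w x|s t w x]; rewrite /G' /= /G.
  - by rewrite !Wcat TH catA.
  - by rewrite mulrA Wcat.
  - by rewrite mulrA -mulrA Wcat.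
have QI x : gen_ideal tensor_rel x -> forall s t, G s t x = 0.
  elim=> {x} [x [c a a' b|c a b b'|a b a' b'|]||x y _ Qx _ Qy|a x _ Qx|a x _ Qx] s t.
  - rewrite (linearB (G s t)) (linearP (G s t)) !Wgen !GW /H !big_cat /= !big_seq1 /=.
    rewrite mulrDl mulrDr -scalerAl -scalerAr phiP.
    by rewrite mulrDl -mulrA subrr.
  - rewrite (linearB (G s t)) (linearP (G s t)) !Wgen !GW /H !big_cat /= !big_seq1 /=.
    rewrite mulrDl mulrDr -scalerAl -scalerAr psiP.
    by rewrite mulrDr mulrCA subrr.
  - rewrite (linearB (G s t)) !Wgen Wcat !GW /H !big_cat /= !big_cons !big_nil.
    by rewrite !mulr1 subrr.
  - rewrite (linearB (G s t)) Wgen Wone !GW /H !big_cat /= !big_seq1 /=.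
    by rewrite !mul1r subrr.
  - exact: linear0.
  - by rewrite linearD Qx Qy addr0.
  - have [c [r ->]] := WE a; rewrite mulr_suml linear_sum big1 // => w _.
    by rewrite -scalerAl linearZZ GL Qx scaler0.
  - have [c [r ->]] := WE a; rewrite mulr_sumr linear_sum big1 // => w _.
    by rewrite -scalerAr linearZZ GR Qx scaler0.
move=> /QI/(_ [::] [::]); rewrite Wone GW /H !big_nil phi1 psi1 mulr1 => /eqP.
by rewrite oner_eq0.
Qed.

Definition tensor_product : algType k := quotalg (ideal_of tensor_proper).

Definition pure_tensor (a : A) (b : B) : tensor_product :=
  qpi (ideal_of tensor_proper) (fgen (a, b)).

End TensorProduct.

(* Increasing exhaustive filtrations of an algebra, indexed by the natural
   numbers, with the convention that the term of index -1 is zero. *)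
Record filtration (k : fieldType) (A : algType k) := Filtration {
  in_fil :> nat -> A -> Prop;
  fil0 : forall n, in_fil n 0;
  filD : forall n x y, in_fil n x -> in_fil n y -> in_fil n (x + y);
  filZ : forall n (c : k) x, in_fil n x -> in_fil n (c *: x);
  filS : forall n x, in_fil n x -> in_fil n.+1 x;
  fil1 : in_fil 0 1;
  filM : forall m n x y, in_fil m x -> in_fil n y -> in_fil (m + n) (x * y);
  fil_exhaustive : forall x, exists n, in_fil n x
}.

Section AssociatedGraded.
Context (k : fieldType) (A : algType k) (F : filtration A).

Definition fil_pred (n : nat) (x : A) : Prop :=
  if n is m.+1 then F m x else x = 0.

Lemma fil_opp n x : F n x -> F n (- x).
Proof. by rewrite -scaleN1r; apply: filZ. Qed.

Lemma fil_sum n (I : Type) (r : seq I) (P : pred I) (G : I -> A) :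
  (forall i, P i -> F n (G i)) -> F n (\sum_(i <- r | P i) G i).
Proof. by move=> FG; apply: big_ind => //; [apply: fil0|apply: filD]. Qed.

Lemma fil_predD n x y : fil_pred n x -> fil_pred n y -> fil_pred n (x + y).
Proof. by case: n => [->->|n]; [rewrite addr0|apply: filD]. Qed.

Lemma fil_pred0 n : fil_pred n 0.
Proof. by case: n => //= n; apply: fil0. Qed.

Lemma fil_pred_sum n (I : Type) (r : seq I) (P : pred I) (G : I -> A) :
  (forall i, P i -> fil_pred n (G i)) -> fil_pred n (\sum_(i <- r | P i) G i).
Proof. by move=> FG; apply: big_ind => //; [apply: fil_pred0|apply: fil_predD]. Qed.

(* The Rees algebra, sum of the F_n t^n inside A[t]. *)
Definition in_rees (p : {poly A}) : bool := `[< forall n, F n p`_n >].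

Lemma in_rees_subring : subring_closed in_rees.
Proof.
split=> [|p q /asboolP Fp /asboolP Fq|p q /asboolP Fp /asboolP Fq]; apply/asboolP => n.
- by rewrite coef1; case: n => [|n] /=; [apply: fil1|apply: fil0].
- by rewrite coefB; apply: filD => //; apply: fil_opp.
- rewrite coefM; apply: fil_sum => i _.
  by have := filM (Fp i) (Fq (n - i)%N); rewrite subnKC // -ltnS.
Qed.

HB.instance Definition _ := GRing.isSubringClosed.Build {poly A} in_rees in_rees_subring.

Record rees := Rees { rees_val :> {poly A}; _ : in_rees rees_val }.
HB.instance Definition _ := [isSub for rees_val].
HB.instance Definition _ := [Choice of rees by <:].
HB.instance Definition _ := [SubChoice_isSubNzRing of rees by <:].

Lemma reesP (p : rees) n : F n (val p)`_n.
Proof. by case: p => p /= /asboolP. Qed.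

Lemma rees_scale_subproof (c : k) (p : rees) : in_rees (c%:A *: val p).
Proof. by apply/asboolP => n; rewrite coefZ mulr_algl; apply/filZ/reesP. Qed.

Definition rees_scale (c : k) (p : rees) : rees := Rees (rees_scale_subproof c p).

Lemma rees_scaleA c d p : rees_scale c (rees_scale d p) = rees_scale (c * d) p.
Proof. by apply: val_inj; rewrite /= scalerA mulr_algl scalerA. Qed.

Lemma rees_scale1 : left_id 1 rees_scale.
Proof. by move=> p; apply: val_inj; rewrite /= !scale1r. Qed.

Lemma rees_scaleDr : right_distributive rees_scale +%R.
Proof. by move=> c p q; apply: val_inj; rewrite /= scalerDr. Qed.

Lemma rees_scaleDl p : {morph rees_scale^~ p : c d / c + d}.
Proof. by move=> c d; apply: val_inj; rewrite /= !scalerDl. Qed.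

HB.instance Definition _ := GRing.Zmodule_isLmodule.Build k rees
  rees_scaleA rees_scale1 rees_scaleDr rees_scaleDl.

Lemma rees_scaleAl c (p q : rees) : c *: (p * q) = (c *: p) * q.
Proof. by apply: val_inj; rewrite /= scalerAl. Qed.

HB.instance Definition _ := GRing.Lmodule_isLalgebra.Build k rees rees_scaleAl.

Lemma rees_scaleAr c (p q : rees) : c *: (p * q) = p * (c *: q).
Proof.
apply: val_inj; apply/polyP => n; rewrite /= coefZ !coefM mulr_sumr.
by apply: eq_bigr => i _; rewrite coefZ !mulr_algl scalerAr.
Qed.

HB.instance Definition _ := GRing.Lalgebra_isAlgebra.Build k rees rees_scaleAr.

(* The ideal of the F_(n-1) t^n, so that the quotient is the sum of the
   F_n / F_(n-1). *)
Definition in_gr_ideal (p : rees) : Prop := forall n, fil_pred n (val p)`_n.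

Lemma gr_ideal0 : in_gr_ideal 0.
Proof. by move=> n; rewrite coef0; apply: fil_pred0. Qed.

Lemma gr_idealD p q : in_gr_ideal p -> in_gr_ideal q -> in_gr_ideal (p + q).
Proof. by move=> Ip Iq n; rewrite coefD; apply: fil_predD. Qed.

Lemma fil_predM m n i x y : (m + n = i)%N ->
  F m x -> fil_pred n y -> fil_pred i (x * y).
Proof.
move=> <-; case: n => [|n] Fx; first by move=> ->; rewrite mulr0; apply: fil_pred0.
by rewrite addnS; apply: filM.
Qed.

Lemma fil_predMr m n i x y : (m + n = i)%N ->
  fil_pred m x -> F n y -> fil_pred i (x * y).
Proof.
move=> <-; case: m => [|m] Fx Fy; first by rewrite Fx mul0r; apply: fil_pred0.
by rewrite addSn; apply: filM.
Qed.

Lemma gr_idealMl a p : in_gr_ideal p -> in_gr_ideal (a * p).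
Proof.
move=> Ip n; rewrite /= coefM; apply: fil_pred_sum => i _.
by apply: (@fil_predM i (n - i)) => //; [rewrite subnKC // -ltnS|apply: reesP].
Qed.

Lemma gr_idealMr a p : in_gr_ideal p -> in_gr_ideal (p * a).
Proof.
move=> Ip n; rewrite /= coefM; apply: fil_pred_sum => i _.
by apply: (@fil_predMr i (n - i)) => //; [rewrite subnKC // -ltnS|apply: reesP].
Qed.

Lemma gr_ideal_proper : ~ in_gr_ideal 1.
Proof. by move=> /(_ 0)/eqP; rewrite /= coef1 oner_eq0. Qed.

Definition gr_ideal : ideal rees :=
  Ideal gr_ideal0 gr_idealD gr_idealMl gr_idealMr gr_ideal_proper.

Definition gr : algType k := quotalg gr_ideal.

(* rees_mono n a is a t^n if a is in F_n, and 0 otherwise. *)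
Definition rees_mono (n : nat) (a : A) : rees := insubd 0 (a *: 'X^n).

Definition gr_symbol (n : nat) (a : A) : gr := qpi gr_ideal (rees_mono n a).

Definition gr_component (n : nat) (u : gr) : gr := gr_symbol n (val (repr u))`_n.

Lemma val_rees_mono n a : F n a -> val (rees_mono n a) = a *: 'X^n.
Proof.
move=> Fa; apply: insubdK; apply/asboolP => m; rewrite coefZ coefXn.
by case: eqP => [->|_]; rewrite ?mulr1 // mulr0; apply: fil0.
Qed.

Lemma gr_symbolP n a b : F n a -> F n b ->
  gr_symbol n a = gr_symbol n b <-> fil_pred n (a - b).
Proof.
move=> Fa Fb; rewrite /gr_symbol qpiP /= /in_gr_ideal.
have E m : (val (rees_mono n a - rees_mono n b))`_m = (a - b) *+ (m == n).
  by rewrite rmorphB /= !val_rees_mono // -scalerBl coefZ coefXn mulr_natr.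
split=> [/(_ n)|H m]; rewrite E ?eqxx //.
by case: eqP => [->|_] //; apply: fil_pred0.
Qed.

Lemma gr_componentE n p : gr_component n (qpi gr_ideal p) = gr_symbol n (val p)`_n.
Proof.
apply/gr_symbolP; [exact: reesP|exact: reesP|].
have /qpiP/(_ n) : qpi gr_ideal (repr (qpi gr_ideal p)) = qpi gr_ideal p.
  exact: qpi_repr.
by rewrite rmorphB coefB.
Qed.

Lemma gr_component_sum (u : gr) :
  exists N, u = \sum_(n < N) gr_component n u.
Proof.
have [p ->] := qpi_surj u; exists (size (val p)).
transitivity (qpi gr_ideal (\sum_(n < size (val p)) rees_mono n (val p)`_n)).
  congr (qpi gr_ideal _); apply: val_inj; rewrite rmorph_sum /= -[LHS]coefK poly_def.
  by apply: eq_bigr => i _; rewrite val_rees_mono //; apply: reesP.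
by rewrite rmorph_sum; apply: eq_bigr => i _; rewrite gr_componentE.
Qed.

End AssociatedGraded.

Section AssociatedGradedMap.
Context (k : fieldType) (A B : algType k) (F : filtration A) (G : filtration B).
Context (f : {lrmorphism A -> B}).
Hypothesis fF : forall n x, F n x -> G n (f x).

Lemma rees_map_subproof (p : rees F) : in_rees G (map_poly f (val p)).
Proof. by apply/asboolP => n; rewrite coef_map; apply/fF/reesP. Qed.

Definition rees_map (p : rees F) : rees G := Rees (rees_map_subproof p).

Lemma rees_map_is_linear : linear rees_map.
Proof.
move=> c p q; apply: val_inj; apply/polyP => n.
by rewrite /= coefD coefZ !coef_map /= coefD coefZ !mulr_algl linearP.
Qed.

Lemma rees_map_is_monoid_morphism : monoid_morphism rees_map.
Proof. by split=> [|p q]; apply: val_inj; rewrite /= ?rmorph1 ?rmorphM. Qed.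

HB.instance Definition _ :=
  GRing.isLinear.Build k (rees F) (rees G) _ rees_map rees_map_is_linear.
HB.instance Definition _ :=
  GRing.isMonoidMorphism.Build (rees F) (rees G) rees_map rees_map_is_monoid_morphism.

Definition rees_map_gr : {lrmorphism rees F -> gr G} := qpi (gr_ideal G) \o rees_map.

Lemma gr_map_subproof p : gr_ideal F p -> rees_map_gr p = 0.
Proof.
move=> Ip; apply/qpi_eq0 => n; rewrite /= coef_map.
by case: n (Ip n) => [/= ->|n /fF //]; rewrite rmorph0.
Qed.

Definition gr_map : gr F -> gr G := quotalg_lift rees_map_gr.

HB.instance Definition _ :=
  GRing.isLinear.Build k (gr F) (gr G) _ gr_map (quotalg_lift_is_linear gr_map_subproof).
HB.instance Definition _ :=
  GRing.isMonoidMorphism.Build (gr F) (gr G) gr_map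
    (quotalg_lift_is_monoid_morphism gr_map_subproof).

Lemma gr_map_symbol n a : F n a -> gr_map (gr_symbol F n a) = gr_symbol G n (f a).
Proof.
move=> Fa; rewrite /gr_map (quotalg_liftE gr_map_subproof) /=.
congr (qpi _ _); apply: val_inj; rewrite /= !val_rees_mono //; last exact: fF.
by apply/polyP => m; rewrite coef_map !coefZ !coefXn !mulr_natr /= raddfMn.
Qed.

End AssociatedGradedMap.

Section PBWFiltration.
Context (k : fieldType) (g : preLieType k).

Definition in_pbw (n : nat) (u : U_PreLie g) : Prop :=
  exists2 s : seq (k * seq (g + g)), all (fun cw => size cw.2 <= n)%N s &
    u = \sum_(cw <- s) cw.1 *: \prod_(i <- cw.2) Ugen i.

Lemma pbw0 n : in_pbw n 0.
Proof. by exists [::]; rewrite ?big_nil. Qed.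

Lemma pbwD n u v : in_pbw n u -> in_pbw n v -> in_pbw n (u + v).
Proof.
by move=> [s sn ->] [t tn ->]; exists (s ++ t); rewrite ?all_cat ?sn // big_cat.
Qed.

Lemma pbwZ n (c : k) u : in_pbw n u -> in_pbw n (c *: u).
Proof.
move=> [s sn ->]; exists [seq (c * cw.1, cw.2) | cw <- s]; first by rewrite all_map.
by rewrite big_map scaler_sumr; apply: eq_bigr => cw _; rewrite scalerA.
Qed.

Lemma pbwS n u : in_pbw n u -> in_pbw n.+1 u.
Proof. by move=> [s sn ->]; exists s => //; apply: sub_all sn => cw /leqW. Qed.

Lemma pbw_word (w : seq (g + g)) : in_pbw (size w) (\prod_(i <- w) Ugen i).
Proof. by exists [:: (1, w)]; rewrite /= ?leqnn // big_seq1 scale1r. Qed.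

Lemma pbw1 : in_pbw 0 1.
Proof. by have := pbw_word [::]; rewrite big_nil. Qed.

Lemma pbwM m n u v : in_pbw m u -> in_pbw n v -> in_pbw (m + n) (u * v).
Proof.
move=> [s sm ->] [t tn ->].
exists [seq (a.1 * b.1, a.2 ++ b.2) | a <- s, b <- t].
  apply/allP => _ /allpairsP[[a b] /= [sa tb ->]] /=.
  by rewrite size_cat leq_add ?(allP sm _ sa) ?(allP tn _ tb).
rewrite big_allpairs_dep /= mulr_suml; apply: eq_bigr => a _.
rewrite mulr_sumr; apply: eq_bigr => b _.
by rewrite /= big_cat -scalerAl -scalerAr scalerA.
Qed.

Lemma pbw_le m n u : (m <= n)%N -> in_pbw m u -> in_pbw n u.
Proof. by move=> /subnK <-; elim: (n - m)%N => // i IH /IH; apply: pbwS. Qed.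

Lemma pbw_exhaustive u : exists n, in_pbw n u.
Proof.
have [x ->] := qpi_surj u; rewrite [x]freealgE; elim: (enum_fset _) => [|w s [n IH]].
  by exists 0; rewrite big_nil rmorph0; apply: pbw0.
exists (maxn (size w) n); rewrite big_cons qpi_add qpi_scale rmorph_prod.
apply: pbwD; last exact: pbw_le (leq_maxr _ _) IH.
by apply/pbwZ/(pbw_le (leq_maxl _ _))/pbw_word.
Qed.

Definition pbw : filtration (U_PreLie g) :=
  Filtration pbw0 pbwD pbwZ pbwS pbw1 pbwM pbw_exhaustive.

End PBWFiltration.

Lemma U_map_pbw (k : fieldType) (g h : preLieType k) (f : prelie_hom g h) n u :
  pbw g n u -> pbw h n (U_map f u).
Proof.
pose f' (i : g + g) : h + h := match i with inl x => inl (f x) | inr x => inr (f x) end.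
move=> [s sn ->]; exists [seq (cw.1, map f' cw.2) | cw <- s].
  by rewrite all_map; apply: sub_all sn => cw /=; rewrite size_map.
rewrite linear_sum big_map; apply: eq_bigr => cw _.
rewrite linearZZ rmorph_prod /= big_map; congr (_ *: _).
by apply: eq_bigr => -[x|x] _; [apply: U_map_r|apply: U_map_l].
Qed.

Definition PBW_property (k : fieldType) : Prop :=
  exists Phi : forall g : preLieType k, {lrmorphism gr (pbw g) -> U_PreLie (null_prelie g)},
    (forall g, bijective (Phi g)) /\
    (forall (g h : preLieType k) (f : prelie_hom g h) (u : gr (pbw g)),
       Phi h (gr_map (U_map_pbw f) u) = U_map (null_hom f) (Phi g u)).

(* A filtration of gr F by graded subspaces; equivalently, a refinement of F
   by subspaces F_(n-1) <= F_(n,0) <= F_(n,1) <= ... with union F_n. *)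
Definition graded_filtration (k : fieldType) (A : algType k) (F : filtration A)
    (G : filtration (gr F)) : Prop :=
  forall m n u, G m u -> G m (gr_component n u).

(* Main.v *)
Require Import Defs.
From HB Require Import structures.
From mathcomp Require Import all_boot all_algebra.
From mathcomp Require Import boolp.

Set Implicit Arguments.
Unset Strict Implicit.
Unset Printing Implicit Defensive.

Import GRing.Theory.
Local Open Scope ring_scope.

(** Write g0 for g with the zero operation, so that U(g0) is generated by
    commuting r_x and by l_x with [l_x, r_y] = l_x l_y.

    Modulo shorter words the symbols of the generators of U(g) satisfy the
    relations of U(g0), whence a natural surjection U(g0) -> gr U(g); the content
    of the PBW property is its injectivity.  A linear relation of length n that
    holds in U(g) up to shorter words must be shown to hold in U(g0).  For this
    it suffices that U(g) acts on U(g0) in such a way that every generator acts as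
    multiplication by its namesake up to terms of lower length: a word of U(g)
    applied to 1 is then the same word of U(g0), up to shorter words.  As in the
    theorem of Guin and Oudom, the pre-Lie operation supplies such an action by
    an explicit formula: l_x acts as multiplication by l_x, and r_x as
    multiplication by r_x plus the derivation N_x induced by the linear map
    y |-> y ▷ x of g.  Right symmetry says [N_x, N_y] = N_(y ▷ x) - N_(x ▷ y),
    and N_y l_x = l_(x ▷ y) produces the correction in the relation between l_x
    and r_y.

    The second statement follows the same pattern one step further.  Filter
    U(g0) by the number of letters r.  As l_x l_y has none, the symbols of l_x and
    r_y commute, whence a surjection of S(g) ⊗ T(g) onto the graded algebra.  It is
    injective because U(g0) acts on S(g) ⊗ T(g): l_x by multiplication, and r_x by
    multiplication plus the derivation E_x that kills S(g) and sends l_y to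
    - l_y l_x, which is what [l_y, r_x] = l_y l_x dictates; these derivations
    commute with one another.

    Both cases are instances of [deformation_bijective]; the actions are
    [prelie_action] and [abelian_action], and the derivations come from the
    universal properties through [derivation_exists].  No basis of g and no
    ordering of monomials enters. *)

(** * The algebra of endomorphisms *)

Section Endomorphisms.
Context (k : fieldType) (A : algType k).

Record endo := Endo { endo_fun :> A -> A; endo_linear : linear endo_fun }.

HB.instance Definition _ (f : endo) :=
  GRing.isLinear.Build k A A _ f (endo_linear f).

HB.instance Definition _ := gen_eqMixin endo.
HB.instance Definition _ := gen_choiceMixin endo.

Lemma endo_ext (f g : endo) : f =1 g -> f = g.
Proof.
case: f g => [f Lf] [g Lg] /= /funext fg; rewrite fg in Lf *.
by congr Endo; apply: Prop_irrelevance.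
Qed.

Definition endo0 : endo := Endo (linearP (\0 : {linear A -> A})).
Definition endo_opp (f : endo) : endo := Endo (linearP (-%R \o f)).
Definition endo_add (f g : endo) : endo := Endo (linearP (f \+ g)).
Definition endo1 : endo := Endo (linearP (idfun : {linear A -> A})).
Definition endo_mul (f g : endo) : endo := Endo (linearP (f \o g)).

Lemma endo_scale_subproof (c : k) (f : endo) : linear (fun x => c *: f x).
Proof. by move=> d x y; rewrite linearP scalerDr scalerA mulrC -scalerA. Qed.
Definition endo_scale (c : k) (f : endo) : endo := Endo (endo_scale_subproof c f).

Lemma endo_addA : associative endo_add.
Proof. by move=> f g h; apply: endo_ext => x /=; rewrite addrA. Qed.
Lemma endo_addC : commutative endo_add.
Proof. by move=> f g; apply: endo_ext => x /=; rewrite addrC. Qed.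
Lemma endo_add0 : left_id endo0 endo_add.
Proof. by move=> f; apply: endo_ext => x /=; rewrite add0r. Qed.
Lemma endo_addN : left_inverse endo0 endo_opp endo_add.
Proof. by move=> f; apply: endo_ext => x /=; rewrite addNr. Qed.
Lemma endo_mulA : associative endo_mul.
Proof. by move=> f g h; apply: endo_ext. Qed.
Lemma endo_mul1l : left_id endo1 endo_mul.
Proof. by move=> f; apply: endo_ext. Qed.
Lemma endo_mul1r : right_id endo1 endo_mul.
Proof. by move=> f; apply: endo_ext. Qed.
Lemma endo_mulDl : left_distributive endo_mul endo_add.
Proof. by move=> f g h; apply: endo_ext. Qed.
Lemma endo_mulDr : right_distributive endo_mul endo_add.
Proof. by move=> f g h; apply: endo_ext => x /=; rewrite linearD. Qed.
Lemma endo1_neq0 : endo1 != endo0.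
Proof. by apply/eqP => /(congr1 (fun f : endo => f 1))/eqP; rewrite /= oner_eq0. Qed.

HB.instance Definition _ := GRing.isNzRing.Build endo
  endo_addA endo_addC endo_add0 endo_addN
  endo_mulA endo_mul1l endo_mul1r endo_mulDl endo_mulDr endo1_neq0.

Lemma endo_scaleA c d f : endo_scale c (endo_scale d f) = endo_scale (c * d) f.
Proof. by apply: endo_ext => x /=; rewrite scalerA. Qed.
Lemma endo_scale1 : left_id 1 endo_scale.
Proof. by move=> f; apply: endo_ext => x /=; rewrite scale1r. Qed.
Lemma endo_scaleDr : right_distributive endo_scale +%R.
Proof. by move=> c f g; apply: endo_ext => x /=; rewrite scalerDr. Qed.
Lemma endo_scaleDl f : {morph endo_scale^~ f : c d / c + d}.
Proof. by move=> c d; apply: endo_ext => x /=; rewrite scalerDl. Qed.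

HB.instance Definition _ := GRing.Zmodule_isLmodule.Build k endo
  endo_scaleA endo_scale1 endo_scaleDr endo_scaleDl.

Lemma endo_scaleAl c (f g : endo) : c *: (f * g) = (c *: f) * g.
Proof. by apply: endo_ext. Qed.

HB.instance Definition _ := GRing.Lmodule_isLalgebra.Build k endo endo_scaleAl.

Lemma endo_scaleAr c (f g : endo) : c *: (f * g) = f * (c *: g).
Proof. by apply: endo_ext => x /=; rewrite linearZZ. Qed.

HB.instance Definition _ := GRing.Lalgebra_isAlgebra.Build k endo endo_scaleAr.

Lemma endoD (f g : endo) x : (f + g) x = f x + g x. Proof. by []. Qed.
Lemma endoN (f : endo) x : (- f) x = - f x. Proof. by []. Qed.
Lemma endoZ c (f : endo) x : (c *: f) x = c *: f x. Proof. by []. Qed.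
Lemma endoM (f g : endo) x : (f * g) x = f (g x). Proof. by []. Qed.
Lemma endo1E x : (1 : endo) x = x. Proof. by []. Qed.
Lemma endo0E x : (0 : endo) x = 0. Proof. by []. Qed.
Definition endoE := (endoD, endoN, endoZ, endoM, endo1E, endo0E).

Lemma lmul_subproof (a : A) : linear ( *%R a).
Proof. by move=> c x y; rewrite mulrDr scalerAr. Qed.
Definition lmul (a : A) : endo := Endo (lmul_subproof a).

Lemma lmulE a x : lmul a x = a * x. Proof. by []. Qed.

Lemma lmul_is_linear : linear lmul.
Proof. by move=> c a b; apply: endo_ext => x; rewrite !endoE !lmulE mulrDl scalerAl. Qed.
Lemma lmul_is_monoid_morphism : monoid_morphism lmul.
Proof. by split=> [|a b]; apply: endo_ext => x; rewrite !endoE !lmulE ?mul1r ?mulrA. Qed.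

HB.instance Definition _ := GRing.isLinear.Build k A endo _ lmul lmul_is_linear.
HB.instance Definition _ :=
  GRing.isMonoidMorphism.Build A endo lmul lmul_is_monoid_morphism.

Lemma lmulP c a b : lmul (c *: a + b) = c *: lmul a + lmul b.
Proof. exact: linearP. Qed.
Lemma lmulB a b : lmul (a - b) = lmul a - lmul b. Proof. exact: raddfB. Qed.
Lemma lmulM a b : lmul (a * b) = lmul a * lmul b. Proof. exact: rmorphM. Qed.

End Endomorphisms.

(** * Words in a family of generators *)

Section Words.
Context (k : fieldType) (A : algType k) (I : Type) (d : I -> nat) (a : I -> A).

Definition word (w : seq I) : A := \prod_(i <- w) a i.
Definition weight (w : seq I) : nat := (\sum_(i <- w) d i)%N.

Inductive wspan (n : nat) : A -> Prop :=
| wspan_zero : wspan n 0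
| wspan_cons c w u of (weight w <= n)%N & wspan n u : wspan n (c *: word w + u).

Lemma wspanD n u v : wspan n u -> wspan n v -> wspan n (u + v).
Proof.
move=> Wu Wv; elim: Wu => [|c w {}u wn _ IH]; first by rewrite add0r.
by rewrite -addrA; apply: wspan_cons.
Qed.

Lemma wspanZ n c u : wspan n u -> wspan n (c *: u).
Proof.
elim=> [|e w {}u wn _ IH]; first by rewrite scaler0; apply: wspan_zero.
by rewrite scalerDr scalerA; apply: wspan_cons.
Qed.

Lemma wspan_word n w : (weight w <= n)%N -> wspan n (word w).
Proof.
move=> wn; rewrite -[word w]scale1r -[_ *: _]addr0.
by apply: wspan_cons => //; apply: wspan_zero.
Qed.

Lemma wspan_le m n u : (m <= n)%N -> wspan m u -> wspan n u.
Proof.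
move=> mn; elim=> [|c w v wm _]; first exact: wspan_zero.
by apply: wspan_cons; apply: leq_trans mn.
Qed.

Lemma wspanM m n u v : wspan m u -> wspan n v -> wspan (m + n) (u * v).
Proof.
move=> Wu Wv; elim: Wu => [|c w {}u wm _ IHu].
  by rewrite mul0r; apply: wspan_zero.
rewrite mulrDl -scalerAl; apply: wspanD IHu; apply: wspanZ.
elim: Wv => [|e w' {}v wn _ IHv]; first by rewrite mulr0; apply: wspan_zero.
rewrite mulrDr -scalerAr /word -big_cat; apply: wspan_cons => //.
by rewrite /weight big_cat /= leq_add.
Qed.

Lemma wspan1 n : wspan n 1.
Proof. by have := @wspan_word n [::]; rewrite /word /weight !big_nil; apply. Qed.

Lemma wspan_gen i : wspan (d i) (a i).
Proof. by have := @wspan_word (d i) [:: i]; rewrite /word /weight !big_seq1; apply. Qed.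

(** Exhaustiveness of the filtration by weight.  By [generatingP] it says that the
    family generates A as an algebra, whatever the weights. *)
Definition generating : Prop := forall u, exists n, wspan n u.

Lemma generatingP : (forall P : A -> Prop, P 1 ->
    (forall c u v, P u -> P v -> P (c *: u + v)) ->
    (forall u v, P u -> P v -> P (u * v)) ->
    (forall i, P (a i)) -> forall u, P u) <-> generating.
Proof.
split=> [ind|gen P P1 PD PM Pa u].
  apply: ind => [|c u v [m Wu] [n Wv]|u v [m Wu] [n Wv]|i].
  - by exists 0; apply: wspan1.
  - exists (maxn m n); apply: wspanD; first apply: wspanZ.
      exact: wspan_le (leq_maxl _ _) Wu.
    exact: wspan_le (leq_maxr _ _) Wv.
  - by exists (m + n)%N; apply: wspanM.
  - by exists (d i); apply: wspan_gen.
have [n] := gen u; elim=> [|c w v _ _ Pv].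
  by rewrite -[0](addNr 1) -scaleN1r; apply: PD.
by apply: PD => //; apply: big_ind => // i.
Qed.

Hypothesis gen : generating.

Lemma wspanS n u : wspan n u -> wspan n.+1 u.
Proof. exact/wspan_le/leqnSn. Qed.

Definition word_filtration : filtration A :=
  Filtration wspan_zero wspanD wspanZ wspanS (wspan1 0) wspanM gen.

Lemma generating_ext (B : algType k) (f g : {lrmorphism A -> B}) :
  (forall i, f (a i) = g (a i)) -> f =1 g.
Proof.
move=> fg; move/generatingP: gen; apply=> [|c u v fu fv|u v fu fv|//].
- by rewrite !rmorph1.
- by rewrite !linearP /= fu fv.
- by rewrite !rmorphM /= fu fv.
Qed.

End Words.

(** * Derivations *)

Section Commutators.
Context (R : pzRingType).
Implicit Types x y z : R.

Lemma commutatorDl x y z : (x + y) * z - z * (x + y) = (x * z - z * x) + (y * z - z * y).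
Proof. by rewrite mulrDl mulrDr opprD addrACA. Qed.

Lemma commutatorDr x y z : x * (y + z) - (y + z) * x = (x * y - y * x) + (x * z - z * x).
Proof. by rewrite mulrDl mulrDr opprD addrACA. Qed.

End Commutators.

Section Derivations.
Context (k : fieldType) (A : algType k).

Definition derivation (D : endo A) : Prop :=
  forall u v, D (u * v) = D u * v + u * D v.

Lemma derivation1 D : derivation D -> D 1 = 0.
Proof.
by move=> /(_ 1 1)/eqP; rewrite !mulr1 mul1r -subr_eq0 opprD addrA subrr sub0r oppr_eq0 => /eqP.
Qed.

Lemma derivationP c D E : derivation D -> derivation E -> derivation (c *: D + E).
Proof.
move=> HD HE u v; rewrite !endoE HD HE scalerDr mulrDl mulrDr -scalerAl -scalerAr.
by rewrite addrACA.
Qed.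

Lemma derivation_commutator D E :
  derivation D -> derivation E -> derivation (D * E - E * D).
Proof.
move=> HD HE u v; rewrite !endoE HE HD !raddfD /= !HD !HE mulrBl mulrBr.
rewrite -opprD [X in _ - X]addrACA opprD addrACA; congr (_ + _).
  by rewrite opprD addrACA subrr addr0.
by rewrite opprD addrACA subrr add0r.
Qed.

(** This turns the relations to be checked for operators of the form
    multiplication plus derivation into relations of the algebra acted upon. *)
Lemma derivation_lmul D u : derivation D -> D * lmul u - lmul u * D = lmul (D u).
Proof.
by move=> HD; apply: endo_ext => v; rewrite !endoE !lmulE HD addrK.
Qed.

Lemma derivation_ext (I : Type) (d : I -> nat) (a : I -> A) (D E : endo A) :
  generating d a -> derivation D -> derivation E ->
  (forall i, D (a i) = E (a i)) -> D = E.
Proof.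
move=> /generatingP ind HD HE DE; apply/endo_ext.
apply: ind => [|c u v eu ev|u v eu ev|//].
- by rewrite !derivation1.
- by rewrite !linearP /= eu ev.
- by rewrite HD HE eu ev.
Qed.

Lemma derivation_wspan (I : Type) (d : I -> nat) (a : I -> A) (D : endo A) :
  derivation D -> (forall i, wspan d a (d i) (D (a i))) ->
  forall n u, wspan d a n u -> wspan d a n (D u).
Proof.
move=> HD Da n u; elim=> [|c w {}u wn _ IH]; first by rewrite linear0; apply: wspan_zero.
rewrite linearP /=; apply: wspanD => //; apply: wspanZ; apply: wspan_le wn _.
elim: w => [|i w IHw]; first by rewrite /word big_nil derivation1 //; apply: wspan_zero.
rewrite /word /weight !big_cons HD; apply: wspanD; apply: wspanM => //.
  exact: wspan_word.
exact: wspan_gen.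
Qed.

Lemma dual_subproof (b e : A) :
  linear (fun x : A * A => (b * x.1, b * x.2 + e * x.1)).
Proof.
move=> c [x y] [z t]; congr pair => /=.
  by rewrite mulrDr scalerAr.
by rewrite !mulrDr -!scalerAr scalerDr addrACA.
Qed.

(** The dual number b + e ε acting on A[ε] = A ⊕ A ε. *)
Definition dual (b e : A) : endo (A * A)%type := Endo (dual_subproof b e).

Lemma dualE b e x : dual b e x = (b * x.1, b * x.2 + e * x.1).
Proof. by []. Qed.

Lemma dualD c b e b' e' :
  c *: dual b e + dual b' e' = dual (c *: b + b') (c *: e + e').
Proof.
apply: endo_ext => -[x y]; rewrite !endoE !dualE /=; congr pair => /=.
  by rewrite mulrDl scalerAl.
by rewrite !mulrDl scalerDr !scalerAl addrACA.
Qed.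

Lemma dualM b e b' e' : dual b e * dual b' e' = dual (b * b') (b * e' + e * b').
Proof.
apply: endo_ext => -[x y]; rewrite !endoE !dualE /=; congr pair => /=.
  by rewrite mulrA.
by rewrite mulrDr mulrDl !mulrA addrA.
Qed.

Lemma dual_commute b e b' e' :
  b * b' = b' * b -> b * e' = e' * b -> e * b' = b' * e ->
  dual b e * dual b' e' = dual b' e' * dual b e.
Proof. by move=> bb be eb; rewrite !dualM bb be eb addrC. Qed.

Lemma dual_commutator b e b' e' c f :
  b * b' - b' * b = b * c -> b * e' - e' * b = b * f -> e * b' - b' * e = e * c ->
  dual b e * dual b' e' - dual b' e' * dual b e = dual b e * dual c f.
Proof.
move=> bb be eb; rewrite !dualM -bb -be -eb addrC -scaleN1r dualD !scaleN1r.
by congr dual; rewrite addrC // [X in _ - X]addrC opprD addrACA.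
Qed.

Lemma dual1 : 1 = dual 1 0.
Proof. by apply: endo_ext => -[x y]; rewrite !endoE !dualE /= mul0r !mul1r addr0. Qed.

(** A morphism to A[ε] lifting the identity is u |-> u + (D u) ε with D a
    derivation.  So for an algebra given by generators and relations, arbitrary
    values on the generators extend to a derivation as soon as the dual numbers
    a_i + e_i ε satisfy the relations. *)
Lemma derivation_exists (I : Type) (d : I -> nat) (a e : I -> A)
    (f : {lrmorphism A -> endo (A * A)%type}) :
  generating d a -> (forall i, f (a i) = dual (a i) (e i)) ->
  exists2 D : endo A, derivation D & forall i, D (a i) = e i.
Proof.
move=> /generatingP ind fa.
have /choice[D fD] : forall u, exists x, f u = dual u x.
  apply: ind => [|c u v [x fu] [y fv]|u v [x fu] [y fv]|i].
  - by exists 0; rewrite rmorph1 dual1.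
  - by exists (c *: x + y); rewrite linearP /= fu fv dualD.
  - by exists (u * y + x * v); rewrite rmorphM /= fu fv dualM.
  - by exists (e i).
have DE u : D u = (f u (1, 0)).2.
  by rewrite fD dualE /= mulr0 add0r mulr1.
have Dlin : linear D by move=> c u v; rewrite !DE linearP.
exists (Endo Dlin) => [u v|i] /=.
  have fuv : f (u * v) = dual (u * v) (u * D v + D u * v) by rewrite rmorphM /= !fD dualM.
  by rewrite [LHS]DE fuv dualE /= mulr0 add0r mulr1 addrC.
by rewrite DE fa dualE /= mulr0 add0r mulr1.
Qed.

End Derivations.

(** * Symbols in an associated graded algebra *)

Section AssociatedGradedSymbols.
Context (k : fieldType) (A : algType k) (F : filtration A).

Lemma fil_pred_sub n u : fil_pred F n u -> F n u.
Proof. by case: n => [->|n /filS //]; apply: fil0. Qed.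

Lemma fil_le m n u : (m <= n)%N -> F m u -> F n u.
Proof. by move=> /subnK <-; elim: (n - m)%N => // i IH /IH; apply: filS. Qed.

Lemma fil_pred_lt m n u : (m < n)%N -> F m u -> fil_pred F n u.
Proof. by case: n => // n mn Fu; apply: fil_le Fu. Qed.

Lemma fil_predZ n c u : fil_pred F n u -> fil_pred F n (c *: u).
Proof. by case: n => [->|n]; [rewrite scaler0|apply: filZ]. Qed.

Lemma gr_symbol_lin n c u v : F n u -> F n v ->
  gr_symbol F n (c *: u + v) = c *: gr_symbol F n u + gr_symbol F n v.
Proof.
move=> Fu Fv; rewrite /gr_symbol -linearP; congr (qpi _ _); apply: val_inj => /=.
rewrite !val_rees_mono //; last by apply: filD => //; apply: filZ.
by rewrite scalerA mulr_algl -scalerDl.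
Qed.

Lemma gr_symbolB n u v : F n u -> F n v ->
  gr_symbol F n (u - v) = gr_symbol F n u - gr_symbol F n v.
Proof. by move=> Fu Fv; rewrite addrC -scaleN1r gr_symbol_lin // scaleN1r addrC. Qed.

Lemma gr_symbol_eq0 n u : fil_pred F n u -> gr_symbol F n u = 0.
Proof.
move=> Fu; have Fnu : F n u by case: n Fu => [->|n /filS //]; apply: fil0.
have <- : gr_symbol F n 0 = 0.
  by rewrite -[0 in LHS](addNr 0) -scaleN1r gr_symbol_lin ?scaleN1r ?addNr //; apply: fil0.
by apply/gr_symbolP; [|apply: fil0|rewrite subr0].
Qed.

Lemma gr_symbolM m n u v : F m u -> F n v ->
  gr_symbol F m u * gr_symbol F n v = gr_symbol F (m + n) (u * v).
Proof.
move=> Fu Fv; rewrite /gr_symbol -rmorphM; congr (qpi _ _); apply: val_inj => /=.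
rewrite !val_rees_mono //; last exact: filM.
apply/polyP=> i; rewrite -mul_polyC -[v *: _]mul_polyC.
by rewrite -(mulrA u%:P) (mulrA 'X^m) -commr_polyXn -!mulrA -exprD mulrA -polyCM mul_polyC addnC.
Qed.

Lemma gr_symbol1 : gr_symbol F 0 1 = 1.
Proof.
rewrite /gr_symbol -(qpi_one (gr_ideal F)); congr (qpi _ _); apply: val_inj => /=.
by rewrite val_rees_mono ?scale1r ?expr0 //; apply: fil1.
Qed.

Lemma gr_component_symbol m n u : F m u ->
  gr_component n (gr_symbol F m u) = if m == n then gr_symbol F m u else 0.
Proof.
move=> Fu; rewrite /gr_symbol gr_componentE val_rees_mono // coefZ coefXn mulr_natr.
case: eqVneq => [->//|_]; apply: gr_symbol_eq0; exact: fil_pred0.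
Qed.

Lemma gr_componentP n c (x y : gr F) :
  gr_component n (c *: x + y) = c *: gr_component n x + gr_component n y.
Proof.
have [[p ->] [q ->]] := (qpi_surj x, qpi_surj y).
rewrite -linearP !gr_componentE -gr_symbol_lin; try exact: reesP.
by rewrite /= coefD coefZ mulr_algl.
Qed.

Lemma gr_symbol_word (I : Type) (d : I -> nat) (a : I -> A) (w : seq I) :
  (forall i, F (d i) (a i)) ->
  F (weight d w) (word a w) /\
  gr_symbol F (weight d w) (word a w) = word (fun i => gr_symbol F (d i) (a i)) w.
Proof.
move=> Fa; elim: w => [|i w [Fw IH]].
  by rewrite /word /weight !big_nil gr_symbol1; split=> //; apply: fil1.
rewrite /word /weight !big_cons; split; first exact: filM.
by rewrite -gr_symbolM // IH.
Qed.

End AssociatedGradedSymbols.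

(** * Recognizing an associated graded algebra *)

(** A morphism theta from B onto gr F that matches generators is an isomorphism
    once A acts on B so that each generator a_i acts as b_i plus an operator N_i
    which raises the filtration by less than the weight of i.  Applying a word
    of A to 1 recovers the corresponding word of B as leading term, so a relation
    among leading terms in A comes from one in B. *)
Section Deformation.
Context (k : fieldType) (A B : algType k) (F : filtration A) (H : filtration B).
Context (I : Type) (d : I -> nat) (a : I -> A) (b : I -> B).
Hypothesis FE : forall n u, F n u <-> wspan d a n u.
Hypothesis HE : forall n u, H n u <-> wspan d b n u.
Context (theta : {lrmorphism B -> gr F}).
Hypothesis theta_gen : forall i, theta (b i) = gr_symbol F (d i) (a i).
Context (rho : {lrmorphism A -> endo B}) (N : I -> endo B).
Hypothesis rho_gen : forall i, rho (a i) = lmul (b i) + N i.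
Hypothesis N_lower : forall i n u, H n u -> fil_pred H (d i + n) (N i u).

Lemma theta_word w :
  F (weight d w) (word a w) /\
  theta (word b w) = gr_symbol F (weight d w) (word a w).
Proof.
have [|Fw ->] := @gr_symbol_word _ _ F _ d a w.
  by move=> i; apply/FE/wspan_gen.
by split=> //; rewrite rmorph_prod; apply: eq_bigr => i _; apply: theta_gen.
Qed.

Lemma rho_word w : fil_pred H (weight d w) (rho (word a w) 1 - word b w).
Proof.
elim: w => [|i w IH].
  by rewrite /word !big_nil rmorph1 endo1E subrr; apply: fil_pred0.
rewrite /word /weight !big_cons rmorphM /= rho_gen !endoE lmulE -/(word a w) -/(word b w).
(* b_i times the error of the shorter word, and the lower order term N_i. *)
rewrite addrAC -mulrBr; apply: fil_predD.
  by apply: fil_predM IH => //; apply/HE/wspan_gen.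
apply: N_lower; rewrite -[rho _ _](subrK (word b w)); apply: filD.
  exact: fil_pred_sub.
exact/HE/wspan_word.
Qed.

Lemma rho_fil_pred n u : fil_pred F n u -> fil_pred H n (rho u 1).
Proof.
case: n => [->|n /FE]; first by rewrite linear0.
elim=> [|c w {}u wn _ IH]; first by rewrite linear0; apply: fil0.
rewrite linearP !endoE; apply: filD => //; apply: filZ.
rewrite -[rho _ _](subrK (word b w)); apply: filD; last exact/HE/wspan_word.
apply/HE/(wspan_le wn)/HE/fil_pred_sub; exact: rho_word.
Qed.

(** Writing u in words of B and replacing every b_i by a_i gives a representative
    in the Rees algebra whose part of degree n acts on 1 as u, up to lower terms. *)
Lemma theta_leading_term n u : H n u -> exists p : rees F,
  theta u = qpi (gr_ideal F) p /\ fil_pred H n (rho (val p)`_n 1 - u).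
Proof.
move=> /HE; elim=> [|c w {}u wn _ [p [thp rhop]]].
  by exists 0; rewrite !rmorph0 coef0 rmorph0 subr0; split=> //; apply: fil_pred0.
have [Fw thw] := theta_word w.
exists (c *: rees_mono F (weight d w) (word a w) + p); split.
  by rewrite !linearP /= thw thp.
rewrite /= val_rees_mono // coefD coefZ mulr_algl coefZ coefXn mulr_natr.
rewrite linearP !endoE opprD addrACA -scalerBr; apply: fil_predD => //.
apply: fil_predZ; have [->|nw] := eqVneq n (weight d w); first exact: rho_word.
rewrite mulr0n linear0 sub0r -scaleN1r; apply: fil_predZ.
by apply: (@fil_pred_lt _ _ _ (weight d w)); [rewrite ltn_neqAle eq_sym nw|apply/HE/wspan_word].
Qed.

(** The kernel of theta sinks through the filtration: the representative of
    degree n now lies in the previous step of F, hence so does its value at 1 in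
    the previous step of H. *)
Lemma theta_lower n u : H n u -> theta u = 0 -> fil_pred H n u.
Proof.
move=> /theta_leading_term[p [-> rhop]] /qpi_eq0/(_ n)/rho_fil_pred rp.
rewrite -[u](subKr (rho (val p)`_n 1)) -scaleN1r.
by apply: fil_predD => //; apply: fil_predZ.
Qed.

Lemma theta_injective : injective theta.
Proof.
move=> u v /eqP; rewrite -subr_eq0 -linearB /= => /eqP th0; apply/eqP.
rewrite -subr_eq0; apply/eqP; have [n] := fil_exhaustive H (u - v).
(* The term of index -1 of H is zero, so the descent ends with u - v = 0. *)
by elim: n => [|n IH] /theta_lower /(_ th0).
Qed.

Lemma theta_surjective x : exists u, theta u = x.
Proof.
have [M ->] := gr_component_sum x.
elim/big_ind: _ => [|_ _ [u <-] [v <-]|i _]; first by exists 0; rewrite linear0.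
  by exists (u + v); rewrite linearD.
rewrite /gr_component; move: (_`_i) (reesP (repr x) i) => y /FE.
elim=> [|c w {}y wi Wy [u thu]].
  by exists 0; rewrite linear0 gr_symbol_eq0 //; apply: fil_pred0.
have [Fw thw] := theta_word w; have Fiw : F i (word a w) by apply/FE/wspan_word.
rewrite gr_symbol_lin //; last exact/FE.
have [wi'|wi'] := eqVneq (weight d w) i.
  by exists (c *: word b w + u); rewrite linearP /= thw thu wi'.
exists u; rewrite thu [X in c *: X]gr_symbol_eq0 ?scaler0 ?add0r //.
by apply: (fil_pred_lt _ Fw); rewrite ltn_neqAle wi'.
Qed.

Lemma deformation_bijective : bijective theta.
Proof.
have /choice[f thf] := theta_surjective.
by exists f => // u; apply: theta_injective; rewrite thf.
Qed.

End Deformation.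

Lemma lrmorphism_inverse (k : fieldType) (A B : algType k) (f : {lrmorphism A -> B}) :
  bijective f -> exists g : {lrmorphism B -> A}, cancel f g /\ cancel g f.
Proof.
case=> g fg gf.
have glin : linear g by move=> c u v; rewrite -[u in LHS]gf -[v in LHS]gf -linearP fg.
have gmul : monoid_morphism g.
  split=> [|u v]; first by rewrite -(rmorph1 f) fg.
  by rewrite -[u in LHS]gf -[v in LHS]gf -rmorphM fg.
pose g' : {lrmorphism B -> A} := HB.pack g (GRing.isLinear.Build k B A _ g glin)
  (GRing.isMonoidMorphism.Build B A g gmul).
by exists g'.
Qed.

(** * Universal properties and the enveloping algebra *)

Section Presentations.
Context (k : fieldType) (X : choiceType).

Lemma quotient_generating (I : ideal (freealg k X)) (d : X -> nat) :
  generating d (fun x => qpi I (fgen x)).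
Proof.
apply/generatingP => P P1 PD PM Pgen u; have [x ->] := qpi_surj u.
have P0 : P 0 by rewrite -[0](addNr 1) -scaleN1r; apply: PD.
rewrite [x]freealgE linear_sum; apply: big_ind => // [v w Pv Pw|w _].
  by rewrite -[v]scale1r; apply: PD.
rewrite linearZZ rmorph_prod -[_ *: _]addr0; apply: PD => //.
by apply: big_ind => // y _; apply: Pgen.
Qed.

Lemma presented_lift (R : freealg k X -> Prop) (proper : ~ gen_ideal R 1)
    (B : algType k) (h : X -> B) :
  (forall x, R x -> feval h x = 0) ->
  exists f : {lrmorphism quotalg (ideal_of proper) -> B},
    forall x, f (qpi _ (fgen x)) = h x.
Proof.
move=> hR; have hI x : ideal_of proper x -> feval h x = 0.
  exact: (@gen_ideal_morph k _ R B (feval h) hR).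
pose f : {lrmorphism quotalg (ideal_of proper) -> B} :=
  HB.pack (@quotalg_lift k _ (ideal_of proper) B (feval h))
    (GRing.isLinear.Build k _ B _ _ (quotalg_lift_is_linear hI))
    (GRing.isMonoidMorphism.Build _ B _ (quotalg_lift_is_monoid_morphism hI)).
by exists f => x; apply: etrans (quotalg_liftE hI _) _; apply: feval_gen.
Qed.

End Presentations.

Definition map_gen (V W : Type) (phi : V -> W) (i : V + V) : W + W :=
  match i with inl x => inl (phi x) | inr x => inr (phi x) end.

Lemma U_map_gen (k : fieldType) (g h : preLieType k) (f : prelie_hom g h) i :
  U_map f (Ugen i) = Ugen (map_gen f i).
Proof. by case: i => x; [apply: U_map_r|apply: U_map_l]. Qed.

Section EnvelopingUniversal.
Context (k : fieldType) (g : preLieType k).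

Lemma Ugen_generating d : generating d (@Ugen k g).
Proof. exact: quotient_generating. Qed.

Lemma U_universal (B : algType k) (h : g + g -> B) :
  linear (fun x => h (inl x)) -> linear (fun x => h (inr x)) ->
  (forall x y, h (inl x) * h (inl y) - h (inl y) * h (inl x) =
               h (inl (y ▷ x)) - h (inl (x ▷ y))) ->
  (forall x y, h (inr x) * h (inl y) - h (inl y) * h (inr x) =
               h (inr x) * h (inr y) - h (inr (x ▷ y))) ->
  exists f : {lrmorphism U_PreLie g -> B}, forall i, f (Ugen i) = h i.
Proof.
move=> Rlin Llin RR LR; apply: presented_lift => _ [c x y|c x y|x y|x y]; rewrite !fevalE.
- by rewrite Rlin subrr.
- by rewrite Llin subrr.
- by rewrite RR subrr.
- by rewrite LR subrr.
Qed.

Lemma pbwE n u : pbw g n u <-> wspan (fun=> 1%N) (@Ugen k g) n u.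
Proof.
split=> [[s sn ->]|].
  elim: s sn => [|[c w] s IH] /=; first by rewrite big_nil => _; apply: wspan_zero.
  move=> /andP[wn sn]; rewrite big_cons; apply: wspan_cons; last exact: IH.
  by rewrite /weight sum1_size.
elim=> [|c w {}u wn _ IH]; first exact: fil0.
apply: filD => //; apply: filZ; apply: (pbw_le (m := size w)); last exact: pbw_word.
by rewrite -sum1_size.
Qed.

End EnvelopingUniversal.

(** * The enveloping algebra of the zero operation *)

Section Abelian.
Context (k : fieldType) (V : lmodType k).

Local Notation U0 := (U_PreLie (null_prelie V)).

(** Indexing by V + V keeps the generators of U(g) and of U(g0) in the same family,
    although g and g0 are different pre-Lie algebras. *)
Definition Ugen0 (i : V + V) : U0 := @Ugen k (null_prelie V) i.

Lemma Ugen0_generating d : generating d Ugen0.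
Proof. exact: Ugen_generating. Qed.

Lemma U0_universal (B : algType k) (h : V + V -> B) :
  linear (fun x => h (inl x)) -> linear (fun x => h (inr x)) ->
  (forall x y, h (inl x) * h (inl y) = h (inl y) * h (inl x)) ->
  (forall x y, h (inr x) * h (inl y) - h (inl y) * h (inr x) = h (inr x) * h (inr y)) ->
  exists f : {lrmorphism U0 -> B}, forall i, f (Ugen0 i) = h i.
Proof.
move=> Rlin Llin RR LR; apply: (@U_universal k (null_prelie V)) => // x y.
  by rewrite RR !subrr.
have h0 : h (inr 0) = 0.
  by rewrite -[0 in LHS](addNr 0) -scaleN1r (Llin (-1)) scaleN1r addNr.
by rewrite LR -[RHS]/(_ - h (inr 0)) h0 subr0.
Qed.

Lemma Ugen0_linl : linear (fun x => Ugen0 (inl x)).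
Proof. exact: (@Ur_is_linear k (null_prelie V)). Qed.

Lemma Ugen0_linr : linear (fun x => Ugen0 (inr x)).
Proof. exact: (@Ul_is_linear k (null_prelie V)). Qed.

Lemma Ugen0_rr x y : Ugen0 (inl x) * Ugen0 (inl y) = Ugen0 (inl y) * Ugen0 (inl x).
Proof. by apply/eqP; rewrite -subr_eq0 (@U_rr k (null_prelie V)) subrr. Qed.

Lemma Ugen0_lr x y : Ugen0 (inr x) * Ugen0 (inl y) - Ugen0 (inl y) * Ugen0 (inr x) =
  Ugen0 (inr x) * Ugen0 (inr y).
Proof.
rewrite (@U_lr k (null_prelie V)).
by rewrite -[X in _ - X]/(Ul (0 : null_prelie V)) linear0 subr0.
Qed.

(** U(g0) is functorial in the vector space, so its relations survive the
    infinitesimal substitution of x + phi x ε for x. *)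
Lemma U0_derivation (phi : V -> V) : linear phi ->
  exists2 D : endo U0, derivation D & forall i, D (Ugen0 i) = Ugen0 (map_gen phi i).
Proof.
move=> philin.
have [|c x y|x y|x y|f fE] :=
  @U0_universal (endo (U0 * U0)%type) (fun i => dual (Ugen0 i) (Ugen0 (map_gen phi i))).
- by move=> c x y; rewrite /= philin !Ugen0_linl dualD.
- by rewrite /= philin !Ugen0_linr dualD.
- by apply: dual_commute; apply: Ugen0_rr.
- by apply: dual_commutator; apply: Ugen0_lr.
exact: derivation_exists (Ugen0_generating (fun=> 0)) fE.
Qed.

End Abelian.

(** * The symbol map of the PBW filtration *)

Section PBWIsomorphism.
Context (k : fieldType) (g : preLieType k).

Local Notation U0 := (U_PreLie (null_prelie g)).

Definition gr_gen (i : g + g) : gr (pbw g) := gr_symbol (pbw g) 1 (Ugen i).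

Lemma Ugen_pbw (i : g + g) : pbw g 1 (Ugen i).
Proof. exact/pbwE/(@wspan_gen _ _ _ (fun=> 1%N)). Qed.

Lemma gr_gen_linl : linear (fun x => gr_gen (inl x)).
Proof.
move=> c x y; rewrite /gr_gen -gr_symbol_lin; try exact: Ugen_pbw.
by congr gr_symbol; apply: Ur_is_linear.
Qed.

Lemma gr_gen_linr : linear (fun x => gr_gen (inr x)).
Proof.
move=> c x y; rewrite /gr_gen -gr_symbol_lin; try exact: Ugen_pbw.
by congr gr_symbol; apply: Ul_is_linear.
Qed.

Lemma gr_genM i j : gr_gen i * gr_gen j = gr_symbol (pbw g) 2 (Ugen i * Ugen j).
Proof. exact: gr_symbolM (Ugen_pbw i) (Ugen_pbw j). Qed.

Lemma gr_gen_commutator i j : gr_gen i * gr_gen j - gr_gen j * gr_gen i =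
  gr_symbol (pbw g) 2 (Ugen i * Ugen j - Ugen j * Ugen i).
Proof.
by rewrite !gr_genM gr_symbolB //; apply: (@filM _ _ _ 1 1); apply: Ugen_pbw.
Qed.

Lemma gr_gen_rr x y : gr_gen (inl x) * gr_gen (inl y) = gr_gen (inl y) * gr_gen (inl x).
Proof.
apply/eqP; rewrite -subr_eq0 gr_gen_commutator U_rr gr_symbol_eq0 //=.
by apply: pbwD; [|apply: (fil_opp (F := pbw g))]; apply: Ugen_pbw.
Qed.

(** The term l_(x ▷ y) has length one and disappears in degree two. *)
Lemma gr_gen_lr x y :
  gr_gen (inr x) * gr_gen (inl y) - gr_gen (inl y) * gr_gen (inr x) =
  gr_gen (inr x) * gr_gen (inr y).
Proof.
have P2 : pbw g 2 (Ul x * Ul y) by apply: (@filM _ _ _ 1 1); apply: Ugen_pbw.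
have P1 : pbw g 1 (Ul (x ▷ y)) by apply: Ugen_pbw.
rewrite gr_gen_commutator U_lr gr_genM.
apply/gr_symbolP => //; first by apply: filD => //; apply/fil_opp/filS.
by rewrite addrAC subrr sub0r; apply: (fil_opp (F := pbw g)).
Qed.

Lemma pbw_symbol : exists theta : {lrmorphism U0 -> gr (pbw g)},
  forall i, theta (Ugen0 i) = gr_gen i.
Proof.
exact: U0_universal gr_gen_linl gr_gen_linr gr_gen_rr gr_gen_lr.
Qed.

End PBWIsomorphism.

(** * The action of U(g) deforming multiplication *)

(** The target algebra B, later U(g0), is kept abstract: only the relations
    between its generators and the action of the derivations on them matter. *)
Section PreLieAction.
Context (k : fieldType) (g : preLieType k) (B : algType k) (b : g + g -> B).
Hypothesis b_gen : generating (fun=> 1%N) b.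
Hypothesis b_linl : linear (fun x => b (inl x)).
Hypothesis b_linr : linear (fun x => b (inr x)).
Hypothesis b_rr : forall x y, b (inl x) * b (inl y) = b (inl y) * b (inl x).
Hypothesis b_lr : forall x y,
  b (inr x) * b (inl y) - b (inl y) * b (inr x) = b (inr x) * b (inr y).
Context (D : g -> endo B).
Hypothesis D_der : forall x, derivation (D x).
Hypothesis D_gen : forall x i, D x (b i) = b (map_gen (fun y => y ▷ x) i).

Lemma prelie_action_lin : linear D.
Proof.
move=> c x y; apply: (derivation_ext b_gen) => //; first exact: derivationP.
by case=> z; rewrite endoE endoE !D_gen /= prelie_is_linearr ?b_linl ?b_linr.
Qed.

(** Both sides are derivations, and on a generator indexed by z the identity is
    right symmetry for z, y, x. *)
Lemma prelie_action_commutator x y :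
  D x * D y - D y * D x = D (y ▷ x) - D (x ▷ y).
Proof.
apply: (derivation_ext b_gen); first exact: derivation_commutator.
  by rewrite addrC -scaleN1r; apply: derivationP.
have sub (z : g) : z ▷ y ▷ x - z ▷ x ▷ y = z ▷ (y ▷ x) - z ▷ (x ▷ y).
  have /eqP := prelie_rsym z y x; rewrite subr_eq => /eqP->.
  by rewrite addrAC [_ - z ▷ (x ▷ y)]addrC addrK addrC.
have [addl addr] := (zmod_morphism_linear b_linl, zmod_morphism_linear b_linr).
by case=> z; rewrite endoE endoE endoE endoE endoE endoE !D_gen /=;
  rewrite -?addl -?addr sub.
Qed.

(** The defining relations of U(g) are exactly the commutators of these operators:
    [D_x, r_y] = r_(y ▷ x) corrects the relation between the r's, and
    [D_y, l_x] = l_(x ▷ y) the one between l and r. *)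
Lemma prelie_action : exists rho : {lrmorphism U_PreLie g -> endo B},
  forall i, rho (Ugen i) = lmul (b i) + (if i is inl x then D x else 0).
Proof.
pose M i := lmul (b i).
have DM x i : D x * M i - M i * D x = M (map_gen (fun z => z ▷ x) i).
  by rewrite derivation_lmul // D_gen.
apply: (@U_universal _ g _ (fun i => M i + if i is inl x then D x else 0)) => /=.
- move=> c x y; rewrite /M b_linl lmulP prelie_action_lin.
  by rewrite scalerDr addrACA.
- by move=> c x y; rewrite !addr0 /M b_linr lmulP.
- move=> x y; rewrite commutatorDl !commutatorDr opprD [RHS]addrACA.
  rewrite -prelie_action_commutator -!lmulM b_rr subrr add0r addrA; congr (_ + _).
  by rewrite -(opprB (D y * _)) !DM addrC.
- move=> x y; rewrite !addr0 commutatorDr -(opprB (D y * _)) DM.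
  by rewrite -!lmulM -lmulB b_lr.
Qed.

End PreLieAction.

(** * The PBW property *)

Section PBWBijective.
Context (k : fieldType) (g : preLieType k).

Local Notation U0 := (U_PreLie (null_prelie g)).

Lemma pbw_action : exists2 N : g + g -> endo U0,
  (forall i n u, pbw (null_prelie g) n u -> pbw (null_prelie g) n (N i u)) &
  exists rho : {lrmorphism U_PreLie g -> endo U0},
    forall i, rho (Ugen i) = lmul (Ugen0 i) + N i.
Proof.
have /choice[D DP] (y : g) : exists D : endo U0, derivation D /\
    forall i, D (Ugen0 i) = Ugen0 (map_gen (fun x => x ▷ y) i).
  by have [D] := U0_derivation (prelie_is_linearl y); exists D.
have Dder y : derivation (D y) by have [] := DP y.
have DE y i : D y (Ugen0 i) = Ugen0 (map_gen (fun x => x ▷ y) i) by have [] := DP y.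
exists (fun i => if i is inl x then D x else 0).
  move=> [x|y] n u; last by move=> _; apply: fil0.
  move=> /pbwE Hu; apply/pbwE; apply: (derivation_wspan (Dder x)) Hu => i.
  by rewrite DE; apply: (@wspan_gen _ _ _ (fun=> 1%N)).
exact: (prelie_action (@Ugen0_generating k g _) (@Ugen0_linl k g) (@Ugen0_linr k g)
  (@Ugen0_rr k g) (@Ugen0_lr k g) Dder DE).
Qed.

Lemma pbw_symbol_bijective (theta : {lrmorphism U0 -> gr (pbw g)}) :
  (forall i, theta (Ugen0 i) = gr_gen i) -> bijective theta.
Proof.
move=> thetaE; have [N NH [rho rhoE]] := pbw_action.
apply: (deformation_bijective (H := pbw (null_prelie g)) (@pbwE _ g) (@pbwE _ (null_prelie g))
   thetaE rhoE) => i n u Hu.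
exact: NH.
Qed.

Lemma pbw_isomorphism : exists2 phi : {lrmorphism gr (pbw g) -> U0},
  bijective phi & forall i, phi (gr_gen i) = Ugen0 i.
Proof.
have [theta thetaE] := pbw_symbol g.
have [phi [thK phiK]] := lrmorphism_inverse (pbw_symbol_bijective thetaE).
exists phi; first by exists theta.
by move=> i; rewrite -thetaE thK.
Qed.

(** The symbol map is surjective, so generation passes from U(g0) to the graded
    algebra. *)
Lemma gr_gen_generating d : generating d (@gr_gen k g).
Proof.
have [theta thetaE] := pbw_symbol g.
have [theta' _ thK] := pbw_symbol_bijective thetaE.
apply/generatingP => P P1 PD PM Pgen u; rewrite -(thK u).
have /generatingP ind := @Ugen0_generating k g d.
move: (theta' u); apply: ind => [|c v w Pv Pw|v w Pv Pw|i].
- by rewrite rmorph1.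
- by rewrite linearP; apply: PD.
- by rewrite rmorphM; apply: PM.
- by rewrite thetaE.
Qed.

End PBWBijective.

Lemma PreLie_PBW (k : fieldType) : PBW_property k.
Proof.
have /all_sig2[Phi PhiB PhiE] (g : preLieType k) := cid2 (pbw_isomorphism g).
exists Phi; split=> // g h f.
pose lhs : {lrmorphism _ -> _} := Phi h \o gr_map (U_map_pbw f).
pose rhs : {lrmorphism _ -> _} := U_map (null_hom f) \o Phi g.
apply: (generating_ext (f := lhs) (g := rhs) (@gr_gen_generating k g (fun=> 0))) => i.
rewrite /= (gr_map_symbol _ (Ugen_pbw i)) PhiE.
transitivity (Phi h (gr_gen (map_gen f i))); first by rewrite /gr_gen -U_map_gen.
by rewrite PhiE (U_map_gen (null_hom f)).
Qed.

(** * Symmetric and tensor algebras and their product *)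

Section TensorSymmetric.
Context (k : fieldType) (V : lmodType k).

Local Notation S := (symmetric_algebra V).
Local Notation T := (tensor_algebra V).
Local Notation ST := (tensor_product S T).

Definition S_gen (x : V) : S := qpi (ideal_of (@S_proper k V)) (fgen x).
Definition T_gen (x : V) : T := qpi (ideal_of (@T_proper k V)) (fgen x).

Lemma S_genC x y : S_gen x * S_gen y = S_gen y * S_gen x.
Proof.
have /qpi_eq0 : ideal_of (@S_proper k V) _ := Gen_base (S_rel_comm x y).
by rewrite !qpiE => /subr0_eq.
Qed.

Lemma S_gen_lin : linear S_gen.
Proof.
move=> c x y.
have /qpi_eq0 : ideal_of (@S_proper k V) _ := Gen_base (S_rel_lin c x y).
by rewrite !qpiE => /subr0_eq.
Qed.

Lemma T_gen_lin : linear T_gen.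
Proof.
move=> c x y.
have /qpi_eq0 : ideal_of (@T_proper k V) _ := Gen_base (T_rel_lin c x y).
by rewrite !qpiE => /subr0_eq.
Qed.

Lemma S_universal (C : algType k) (h : V -> C) : linear h ->
  (forall x y, h x * h y = h y * h x) ->
  exists f : {lrmorphism S -> C}, forall x, f (S_gen x) = h x.
Proof.
move=> hlin hC; apply: presented_lift => _ [c x y|x y]; rewrite !fevalE.
  by rewrite hlin subrr.
by rewrite hC subrr.
Qed.

Lemma T_universal (C : algType k) (h : V -> C) : linear h ->
  exists f : {lrmorphism T -> C}, forall x, f (T_gen x) = h x.
Proof.
move=> hlin; apply: presented_lift => _ [c x y]; rewrite !fevalE.
by rewrite hlin subrr.
Qed.

End TensorSymmetric.

Section TensorProductUniversal.
Context (k : fieldType) (A B : algType k).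

Local Notation AB := (tensor_product A B).
Local Notation "a ⊗ b" := (pure_tensor a b) (at level 40).

Lemma tensor_rel0 u : tensor_rel u -> qpi (ideal_of (@tensor_proper k A B)) u = 0.
Proof. by move=> Ru; apply/qpi_eq0; apply: Gen_base. Qed.

Lemma pure_tensor_linl c (a a' : A) (b : B) :
  (c *: a + a') ⊗ b = c *: (a ⊗ b) + a' ⊗ b.
Proof. by have := tensor_rel0 (tensor_rel_linl c a a' b); rewrite !qpiE => /subr0_eq. Qed.

Lemma pure_tensor_linr c (a : A) (b b' : B) :
  a ⊗ (c *: b + b') = c *: (a ⊗ b) + a ⊗ b'.
Proof. by have := tensor_rel0 (tensor_rel_linr c a b b'); rewrite !qpiE => /subr0_eq. Qed.

Lemma pure_tensorM (a a' : A) (b b' : B) : (a ⊗ b) * (a' ⊗ b') = (a * a') ⊗ (b * b').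
Proof. by have := tensor_rel0 (tensor_rel_mul a b a' b'); rewrite !qpiE => /subr0_eq. Qed.

Lemma pure_tensorC (a a' : A) (b b' : B) : a * a' = a' * a -> b * b' = b' * b ->
  (a ⊗ b) * (a' ⊗ b') = (a' ⊗ b') * (a ⊗ b).
Proof. by move=> aC bC; rewrite !pure_tensorM aC bC. Qed.

Lemma pure_tensor1 : (1 : A) ⊗ (1 : B) = 1.
Proof. by have := tensor_rel0 (@tensor_rel_one k A B); rewrite qpi_add qpi_opp => /subr0_eq. Qed.

Lemma tensor_universal (C : algType k) (f : {lrmorphism A -> C}) (h : {lrmorphism B -> C}) :
  (forall a b, h b * f a = f a * h b) ->
  exists F : {lrmorphism AB -> C}, forall a b, F (a ⊗ b) = f a * h b.
Proof.
move=> fh; have [|F FE] := @presented_lift k _ _ (@tensor_proper k A B) C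
  (fun x => f x.1 * h x.2); last by exists F => a b; apply: (FE (a, b)).
move=> _ [c a a' b|c a b b'|a b a' b'|]; rewrite !fevalE /=.
- by rewrite linearP mulrDl -scalerAl subrr.
- by rewrite linearP mulrDr -scalerAr subrr.
- by rewrite !rmorphM mulrA -(mulrA (f a)) fh !mulrA subrr.
- by rewrite !rmorph1 mul1r subrr.
Qed.

(** Pure tensors are products (a ⊗ 1)(1 ⊗ b). *)
Lemma tensor_generating (I J : Type) (d : I -> nat) (e : J -> nat)
    (a : I -> A) (b : J -> B) : generating d a -> generating e b ->
  generating (fun i => match i with inl i => d i | inr j => e j end)
    (fun i => match i with inl i => a i ⊗ 1 | inr j => 1 ⊗ b j end).
Proof.
move=> /generatingP indA /generatingP indB; apply/generatingP => P P1 PD PM Pab.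
have PA x : P (x ⊗ 1).
  apply: (indA (fun x => P (x ⊗ 1))) => [|c u v Pu Pv|u v Pu Pv|i].
  - by rewrite pure_tensor1.
  - by rewrite pure_tensor_linl; apply: PD.
  - by rewrite -[1](mulr1 1) -pure_tensorM; apply: PM.
  - exact: (Pab (inl i)).
have PB y : P (1 ⊗ y).
  apply: (indB (fun y => P (1 ⊗ y))) => [|c u v Pu Pv|u v Pu Pv|j].
  - by rewrite pure_tensor1.
  - by rewrite pure_tensor_linr; apply: PD.
  - by rewrite -[1](mulr1 1) -pure_tensorM; apply: PM.
  - exact: (Pab (inr j)).
have /generatingP := @quotient_generating k _ (ideal_of (@tensor_proper k A B)) (fun=> 0).
apply=> // -[x y]; rewrite -/(pure_tensor x y) -[x]mulr1 -[y]mul1r -pure_tensorM.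
exact: PM.
Qed.

End TensorProductUniversal.

Lemma generating_commute (k : fieldType) (A C : algType k) (I : Type) (d : I -> nat)
    (a : I -> A) (f : {lrmorphism A -> C}) (z : C) : generating d a ->
  (forall i, f (a i) * z = z * f (a i)) -> forall u, f u * z = z * f u.
Proof.
move=> /generatingP ind fz; apply: ind => [|c u v fu fv|u v fu fv|//].
- by rewrite rmorph1 mul1r mulr1.
- by rewrite linearP /= mulrDl mulrDr fv -scalerAl -scalerAr fu.
- by rewrite rmorphM /= -mulrA fv mulrA fu mulrA.
Qed.

Section SymmetricTensorGenerators.
Context (k : fieldType) (V : lmodType k).

Local Notation S := (symmetric_algebra V).
Local Notation T := (tensor_algebra V).
Local Notation ST := (tensor_product S T).

Definition r_weight (i : V + V) : nat := if i is inl _ then 1 else 0.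

Definition ST_gen (i : V + V) : ST :=
  match i with
  | inl x => pure_tensor (S_gen x) 1
  | inr x => pure_tensor 1 (T_gen x)
  end.

Lemma ST_generating : generating r_weight ST_gen.
Proof.
exact: tensor_generating (quotient_generating (fun=> 1%N)) (quotient_generating (fun=> 0%N)).
Qed.

Lemma ST_universal (C : algType k) (h : V + V -> C) :
  linear (fun x => h (inl x)) -> linear (fun x => h (inr x)) ->
  (forall x y, h (inl x) * h (inl y) = h (inl y) * h (inl x)) ->
  (forall x y, h (inr x) * h (inl y) = h (inl y) * h (inr x)) ->
  exists f : {lrmorphism ST -> C}, forall i, f (ST_gen i) = h i.
Proof.
move=> Slin Tlin SS TS.
have [f fE] := S_universal Slin SS; have [e eE] := T_universal Tlin.
have [|F FE] := @tensor_universal k _ _ C f e.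
  move=> u v; apply: (generating_commute (quotient_generating (fun=> 0%N)) _ v) => x.
  apply: esym; apply: (generating_commute (quotient_generating (fun=> 0%N)) _ u) => y.
  by rewrite [f _]fE [e _]eE TS.
by exists F => -[x|x]; rewrite FE rmorph1 ?mulr1 ?mul1r ?fE ?eE.
Qed.

Lemma ST_gen_linl : linear (fun x => ST_gen (inl x)).
Proof. by move=> c x y; rewrite /= S_gen_lin pure_tensor_linl. Qed.

Lemma ST_gen_linr : linear (fun x => ST_gen (inr x)).
Proof. by move=> c x y; rewrite /= T_gen_lin pure_tensor_linr. Qed.

Lemma ST_gen_ll x y : ST_gen (inl x) * ST_gen (inl y) = ST_gen (inl y) * ST_gen (inl x).
Proof. exact: pure_tensorC (S_genC x y) (erefl _). Qed.

Lemma ST_gen_rl x y : ST_gen (inr x) * ST_gen (inl y) = ST_gen (inl y) * ST_gen (inr x).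
Proof. by apply: pure_tensorC; rewrite mul1r mulr1. Qed.

End SymmetricTensorGenerators.

(** * The action of U(g0) on S(g) ⊗ T(g) *)

(** As before the algebra acted upon is abstract; it stands for S(g) ⊗ T(g) with its
    universal property. *)
Section AbelianAction.
Context (k : fieldType) (V : lmodType k) (B : algType k) (b : V + V -> B).
Hypothesis b_gen : generating (@r_weight k V) b.
Hypothesis b_linl : linear (fun x => b (inl x)).
Hypothesis b_linr : linear (fun x => b (inr x)).
Hypothesis b_ll : forall x y, b (inl x) * b (inl y) = b (inl y) * b (inl x).
Hypothesis b_rl : forall x y, b (inr x) * b (inl y) = b (inl y) * b (inr x).
Hypothesis b_universal : forall (C : algType k) (h : V + V -> C),
  linear (fun x => h (inl x)) -> linear (fun x => h (inr x)) ->
  (forall x y, h (inl x) * h (inl y) = h (inl y) * h (inl x)) ->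
  (forall x y, h (inr x) * h (inl y) = h (inl y) * h (inr x)) ->
  exists f : {lrmorphism B -> C}, forall i, f (b i) = h i.

(** The relation [l_y, r_x] = l_y l_x of U(g0) must hold for the operators l_y and
    r_x + E_x, where l_y and r_x commute; this forces E_x l_y = - l_y l_x. *)
Definition abelian_der_gen (x : V) (i : V + V) : B :=
  if i is inr y then - (b (inr y) * b (inr x)) else 0.

Lemma abelian_derivation x : exists D : endo B,
  derivation D /\ forall i, D (b i) = abelian_der_gen x i.
Proof.
pose h i := dual (b i) (abelian_der_gen x i).
have [||y z|y z|f fE] := @b_universal _ h.
- by move=> c y z; rewrite /h b_linl dualD scaler0 addr0.
- by move=> c y z; rewrite /h /= b_linr dualD mulrDl -scalerAl opprD scalerN.
- by apply: dual_commute; rewrite /= ?mulr0 ?mul0r.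
- apply: dual_commute; rewrite /= ?mulr0 ?mul0r //.
  by rewrite mulNr mulrN -mulrA b_rl !mulrA b_rl.
by have [D] := derivation_exists b_gen fE; exists D.
Qed.

Context (D : V -> endo B).
Hypothesis D_der : forall x, derivation (D x).
Hypothesis D_gen : forall x i, D x (b i) = abelian_der_gen x i.

Lemma abelian_derivation_lin : linear D.
Proof.
move=> c x y; apply: (derivation_ext b_gen) => //; first exact: derivationP.
case=> z; rewrite endoE endoE !D_gen /=; first by rewrite scaler0 addr0.
by rewrite b_linr mulrDr -scalerAr opprD scalerN.
Qed.

(** E_x E_y l_z = l_z l_x l_y + l_z l_y l_x is symmetric in x and y. *)
Lemma abelian_derivationC x y : D x * D y = D y * D x.
Proof.
apply/eqP; rewrite -subr_eq0; apply/eqP.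
apply: (derivation_ext b_gen); first exact: derivation_commutator.
  by move=> u v; rewrite !endoE mul0r mulr0 addr0.
case=> z; rewrite endoE endoE endoE endoE endoE !D_gen /= ?linear0 ?addr0 //.
rewrite !linearN /= !D_der !D_gen /=.
rewrite !mulNr !mulrN -!opprD !opprK !mulrA.
by rewrite [X in X - _]addrC subrr.
Qed.

Lemma abelian_action : exists rho : {lrmorphism U_PreLie (null_prelie V) -> endo B},
  forall i, rho (Ugen0 i) = lmul (b i) + (if i is inl x then D x else 0).
Proof.
have DM x i : D x * lmul (b i) - lmul (b i) * D x = lmul (abelian_der_gen x i).
  by rewrite derivation_lmul // D_gen.
apply: (@U0_universal _ V _ (fun i => lmul (b i) + if i is inl x then D x else 0)) => /=.
- move=> c x y; rewrite b_linl lmulP abelian_derivation_lin.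
  by rewrite scalerDr addrACA.
- by move=> c x y; rewrite !addr0 b_linr lmulP.
- move=> x y; apply/eqP; rewrite -subr_eq0 commutatorDl !commutatorDr.
  rewrite abelian_derivationC -(opprB (D y * _)) !DM /= -!lmulM b_ll !subrr.
  by rewrite raddf0 oppr0 !addr0.
- move=> x y; rewrite !addr0 commutatorDr -(opprB (D y * _)) DM /=.
  by rewrite -!lmulM b_rl subrr add0r raddfN /= opprK.
Qed.

End AbelianAction.

(** * The refined filtration *)

Section SecondFiltration.
Context (k : fieldType) (g : preLieType k).

Local Notation ST := (tensor_product (symmetric_algebra g) (tensor_algebra g)).

(** The filtration by the number of letters r. *)
Definition r_filtration : filtration (gr (pbw g)) :=
  word_filtration (@gr_gen_generating k g (@r_weight k g)).

(** Each word in the symbols of the generators is homogeneous for the PBW degree. *)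
Lemma r_filtration_graded : graded_filtration r_filtration.
Proof.
move=> m n u; rewrite /= => Gu; elim: Gu => [|c w {}u wm _ IH].
  rewrite -[X in gr_component _ X]/(qpi (gr_ideal (pbw g)) 0) gr_componentE coef0.
  by rewrite gr_symbol_eq0; [apply: wspan_zero|apply: fil_pred0].
rewrite gr_componentP; apply: wspanD => //; apply: wspanZ.
have [Fw sw] := gr_symbol_word w (@Ugen_pbw k g).
(* The word is the symbol, in degree its length, of the same word in U(g). *)
rewrite -sw (gr_component_symbol _ Fw); case: ifP => _; last exact: wspan_zero.
by rewrite sw; apply: wspan_word.
Qed.

Lemma gr_gen_fil i : r_filtration (r_weight i) (gr_gen i).
Proof. exact: wspan_gen. Qed.

Definition grgr_gen (i : g + g) : gr r_filtration :=
  gr_symbol r_filtration (r_weight i) (gr_gen i).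

Lemma grgr_genM i j : grgr_gen i * grgr_gen j =
  gr_symbol r_filtration (r_weight i + r_weight j) (gr_gen i * gr_gen j).
Proof. exact: gr_symbolM (gr_gen_fil i) (gr_gen_fil j). Qed.

(** The commutator of the symbols of l_x and r_y is l_x l_y, of r-degree 0 instead
    of 1, so it vanishes in the graded algebra. *)
Lemma ST_symbol : exists theta : {lrmorphism ST -> gr r_filtration},
  forall i, theta (ST_gen i) = grgr_gen i.
Proof.
apply: ST_universal => [c x y|c x y|x y|x y].
- exact: etrans (congr1 (gr_symbol r_filtration 1) (gr_gen_linl c x y))
    (gr_symbol_lin c (gr_gen_fil (inl x)) (gr_gen_fil (inl y))).
- exact: etrans (congr1 (gr_symbol r_filtration 0) (gr_gen_linr c x y))
    (gr_symbol_lin c (gr_gen_fil (inr x)) (gr_gen_fil (inr y))).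
- apply: etrans (grgr_genM _ _) (etrans _ (esym (grgr_genM _ _))).
  by rewrite gr_gen_rr.
apply: etrans (grgr_genM _ _) (etrans _ (esym (grgr_genM _ _))).
apply/gr_symbolP.
- exact: (filM (gr_gen_fil (inr x)) (gr_gen_fil (inl y))).
- exact: (filM (gr_gen_fil (inl y)) (gr_gen_fil (inr x))).
by rewrite gr_gen_lr; exact: (filM (gr_gen_fil (inr x)) (gr_gen_fil (inr y))).
Qed.

Lemma ST_symbol_bijective (theta : {lrmorphism ST -> gr r_filtration}) :
  (forall i, theta (ST_gen i) = grgr_gen i) -> bijective theta.
Proof.
move=> thetaE; have [phi _ phiE] := pbw_isomorphism g.
have gen := @ST_generating k g.
have /choice[D DP] := abelian_derivation gen (@ST_gen_linl k g) (@ST_gen_linr k g)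
  (@ST_gen_ll k g) (@ST_gen_rl k g) (@ST_universal k g).
have Dder y : derivation (D y) by have [] := DP y.
have DE y i : D y (ST_gen i) = abelian_der_gen (@ST_gen k g) y i by have [] := DP y.
have [rho rhoE] := abelian_action gen (@ST_gen_linl k g) (@ST_gen_linr k g)
  (@ST_gen_ll k g) (@ST_gen_rl k g) Dder DE.
pose rho' : {lrmorphism gr (pbw g) -> endo ST} := rho \o phi.
apply: (@deformation_bijective _ _ _ r_filtration (word_filtration gen) _ _
  (@gr_gen k g) (@ST_gen k g) (fun _ _ => iff_refl _) (fun _ _ => iff_refl _)
  theta thetaE rho' (fun i => if i is inl x then D x else 0)) => [i|[x|x] n u Hu].
- by rewrite /= phiE rhoE.
- apply: (derivation_wspan (Dder x)) Hu => -[y|y]; rewrite DE /=.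
    exact: wspan_zero.
  rewrite -scaleN1r; apply: wspanZ; apply: (@wspanM _ _ _ _ _ 0 0).
    exact: (wspan_gen _ _ (inr y)).
  exact: (wspan_gen _ _ (inr x)).
- exact: fil_pred0.
Qed.

End SecondFiltration.

Theorem theorem5p3 (k : fieldType) (char0 : [pchar k] =i pred0) :
  PBW_property k /\
  forall g : preLieType k,
    exists G : filtration (gr (pbw g)),
      graded_filtration G /\
      exists Psi : {lrmorphism gr G ->
                      tensor_product (symmetric_algebra g) (tensor_algebra g)},
        bijective Psi.
Proof.
split=> [|g]; first exact: PreLie_PBW.
exists (r_filtration g); split; first exact: r_filtration_graded.
have [theta thetaE] := ST_symbol g.
have [Psi [thK PsiK]] := lrmorphism_inverse (ST_symbol_bijective thetaE).
by exists Psi; exists theta.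
Qed.
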